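(* Let $Q\ge1$ and $0<s<Q$. Let $(X,d_X,\mu)$ be a proper metric measure space that is locally $Q$-homogeneous and supports a local $Q$-Poincaré inequality, and let $\pi\colon X\to W$ be a locally David–Semmes $s$-regular map onto a proper metric space $W$. Let $Y$ be any metric space and $p>Q$. If $f\colon X\to Y$ is continuous and has an upper gradient in $L^p_{\mathrm{loc}}(X)$, then for each $\alpha\in\left(s,\frac{ps}{p-Q+s}\right]$, $$\dim\{a\in W:\dim f(\pi^{-1}(a))\ge\alpha\}\le (Q-s)-p\left(1-\frac{s}{\alpha}\right).$$
   Context: A metric measure space is a metric space with a Borel measure $\mu$ giving positive finite measure to nonempty open sets; proper means closed balls are compact. $\dim$ denotes Hausdorff dimension (the set with restricted metric). Locally $Q$-homogeneous: for every compact $K\subseteq X$ there are $R>0$, $C\ge1$ with $\mu(B(x,r_2))/r_2^Q\le C\mu(B(x,r_1))/r_1^Q$ for $x\in K$, $0<r_1\le r_2<R$. Upper gradient of a continuous $f\colon X\to Y$: Borel $g\colon X\to[0,\infty]$ with $d_Y(f(\gamma(0)),f(\gamma(1)))\le\int_\gamma g\,ds$ for all rectifiable curves $\gamma\colon[0,1]\to X$. Local $Q$-Poincaré inequality: for every compact $K$ there are $C,\sigma\ge1$, $R>0$ such that for every continuous $u\colon X\to\mathbb{R}$ with upper gradient $g$ and every ball $B$ centered in $K$ with radius $<R$, $\frac{1}{\mu(B)}\int_B|u-u_B|d\mu\le C\operatorname{diam}B(\frac{1}{\mu(\sigma B)}\int_{\sigma B}g^Q d\mu)^{1/Q}$. A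 surjection $\pi\colon X\to W$ between proper metric spaces is locally David–Semmes $s$-regular ($s\ge0$) if for every compact $K\subseteq X$, $\pi|_K$ is Lipschitz and there are $C\ge1$, $r_0>0$ such that for every ball $B\subseteq W$ of radius $r<r_0$, the set $\pi^{-1}(B)\cap K$ can be covered by at most $Cr^{-s}$ balls in $X$ of radius $Cr$. Then $(X,W,\pi)$ is called an $s$-foliation. *)

(* Defs.v *)
From HB Require Import structures.
From mathcomp Require Import all_boot all_order all_algebra.
From mathcomp Require Import all_classical all_reals all_analysis measurable_realfun.
Set Implicit Arguments. Unset Strict Implicit. Unset Printing Implicit Defensive.
Import Order.TTheory GRing.Theory Num.Theory.
Local Open Scope classical_set_scope.
Local Open Scope ring_scope.

Section MetricDefs.
Variable R : realType.

Definition is_metric (T : Type) (d : T -> T -> R) : Prop :=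
  (forall x y, 0 <= d x y) /\ (forall x y, d x y = 0 <-> x = y) /\
  (forall x y, d x y = d y x) /\ (forall x y z, d x z <= d x y + d y z).

Definition mball (T : Type) (d : T -> T -> R) (x : T) (r : R) : set T :=
  [set y | d x y < r].
Definition mcball (T : Type) (d : T -> T -> R) (x : T) (r : R) : set T :=
  [set y | d x y <= r].

Definition mopen (T : Type) (d : T -> T -> R) (U : set T) : Prop :=
  forall x, U x -> exists2 r, 0 < r & mball d x r `<=` U.

Definition mcompact (T : Type) (d : T -> T -> R) (K : set T) : Prop :=
  forall (I : Type) (U : I -> set T), (forall i, mopen d (U i)) ->
    K `<=` \bigcup_i U i ->
    exists2 F : set I, finite_set F & K `<=` \bigcup_(i in F) U i.

Definition mproper (T : Type) (d : T -> T -> R) : Prop :=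
  forall x r, mcompact d (mcball d x r).

Definition mcontinuous (T U : Type) (dT : T -> T -> R) (dU : U -> U -> R)
  (f : T -> U) : Prop :=
  forall x e, 0 < e -> exists2 del, 0 < del &
    forall y, dT x y < del -> dU (f x) (f y) < e.

(** Diameter (extended real; diam of the empty set is 0). *)
Definition mdiam (T : Type) (d : T -> T -> R) (E : set T) : \bar R :=
  ereal_sup ([set 0%E] `|` [set (d x y)%:E | x in E & y in E]).

Definition hausdorff_delta (T : Type) (d : T -> T -> R) (t del : R)
    (A : set T) : \bar R :=
  ereal_inf [set (\sum_(0 <= i <oo) ((fine (mdiam d (E i))) `^ t)%:E)%E
            | E in [set E : nat -> set T |
                     A `<=` \bigcup_i E i /\ forall i, (mdiam d (E i) <= del%:E)%E]].

Definition hausdorff_measure (T : Type) (d : T -> T -> R) (t : R)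
    (A : set T) : \bar R :=
  ereal_sup [set hausdorff_delta d t del A | del in [set del : R | 0 < del]].

Definition hdim (T : Type) (d : T -> T -> R) (A : set T) : \bar R :=
  ereal_inf [set t%:E | t in [set t : R | 0 < t /\ hausdorff_measure d t A = 0%E]].

(** Curves gamma : [0,1] -> T (represented as functions on R, only the values
    on [0,1] matter). *)
Definition curve_continuous (T : Type) (d : T -> T -> R) (g : R -> T) : Prop :=
  forall t, 0 <= t <= 1 -> forall e, 0 < e -> exists2 del, 0 < del &
    forall t', 0 <= t' <= 1 -> `|t - t'| < del -> d (g t) (g t') < e.

Definition curve_length (T : Type) (d : T -> T -> R) (g : R -> T) (a b : R)
    : \bar R :=
  ereal_sup [set (\sum_(i < size s)
                   d (g (nth a (a :: s) i)) (g (nth a (a :: s) i.+1)))%:E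
            | s in [set s : seq R | path <=%R a s /\ last a s = b]].

Definition rectifiable (T : Type) (d : T -> T -> R) (g : R -> T) : Prop :=
  curve_continuous d g /\ (curve_length d g 0 1 < +oo)%E.

Definition length_fun (T : Type) (d : T -> T -> R) (g : R -> T) (t : R) : R :=
  fine (curve_length d g 0 t).

(** arc-length parametrization: gamma_s (s_gamma t) = gamma t *)
Definition arclength_param (T : Type) (d : T -> T -> R) (g : R -> T) (u : R) : T :=
  g (xget 0 [set t : R | 0 <= t <= 1 /\ length_fun d g t = u]).

Definition line_integral (T : Type) (d : T -> T -> R) (gam : R -> T)
    (g : T -> \bar R) : \bar R :=
  (\int[@lebesgue_measure R]_(u in `[0%R, length_fun d gam 1%R]%classic)
      g (arclength_param d gam u))%E.

End MetricDefs.

Section MMS.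
Variable R : realType.
Local Open Scope ereal_scope.

Definition borel_of (disp : measure_display) (X : measurableType disp)
    (d : X -> X -> R) : Prop :=
  (@measurable disp X) = <<s [set U : set X | mopen d U] >>.

Definition proper_mms (disp : measure_display) (X : measurableType disp)
    (d : X -> X -> R) (mu : {measure set X -> \bar R}) : Prop :=
  [/\ is_metric d, mproper d, borel_of d &
      forall U : set X, mopen d U -> U !=set0 -> 0 < mu U < +oo].

Definition upper_gradient (disp : measure_display) (X : measurableType disp)
    (dX : X -> X -> R) (Y : Type) (dY : Y -> Y -> R) (f : X -> Y)
    (g : X -> \bar R) : Prop :=
  [/\ measurable_fun [set: X] g, (forall x, 0 <= g x) &
      forall gam : R -> X, rectifiable dX gam ->
        (dY (f (gam 0%R)) (f (gam 1%R)))%:E <= line_integral dX gam g].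

Definition locally_homogeneous (disp : measure_display) (X : measurableType disp)
    (d : X -> X -> R) (mu : {measure set X -> \bar R}) (Q : R) : Prop :=
  forall K : set X, mcompact d K ->
    exists Rad C : R, [/\ (0 < Rad)%R, (1 <= C)%R &
      forall x r1 r2, K x -> (0 < r1)%R -> (r1 <= r2)%R -> (r2 < Rad)%R ->
        mu (mball d x r2) * ((r2 `^ Q)^-1)%:E <=
        C%:E * (mu (mball d x r1) * ((r1 `^ Q)^-1)%:E)].

Definition mean_osc (disp : measure_display) (X : measurableType disp)
    (mu : {measure set X -> \bar R}) (B : set X) (u : X -> R) : \bar R :=
  let mB := fine (mu B) in
  let uB := (mB^-1 * fine (\int[mu]_(y in B) (u y)%:E))%R in
  ((mB^-1)%:E * \int[mu]_(y in B) (`|u y - uB|)%:E).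

Definition local_poincare (disp : measure_display) (X : measurableType disp)
    (d : X -> X -> R) (mu : {measure set X -> \bar R}) (Q : R) : Prop :=
  forall K : set X, mcompact d K ->
    exists C sig Rad : R, [/\ (1 <= C)%R, (1 <= sig)%R, (0 < Rad)%R &
      forall (u : X -> R) (g : X -> \bar R),
        mcontinuous d (fun a b : R => `|a - b|%R) u ->
        upper_gradient d (fun a b : R => `|a - b|%R) u g ->
        forall x r, K x -> (0 < r)%R -> (r < Rad)%R ->
          mean_osc mu (mball d x r) u <=
          C%:E * mdiam d (mball d x r) *
          (((fine (mu (mball d x (sig * r))))^-1)%:E *
             \int[mu]_(y in mball d x (sig * r)) (g y `^ Q)) `^ (Q^-1)].

Definition locally_DS_regular (X W : Type) (dX : X -> X -> R)
    (dW : W -> W -> R) (pi : X -> W) (s : R) : Prop :=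
  (forall w, exists x, pi x = w) /\
  forall K : set X, mcompact dX K ->
    (exists L : R, forall x y, K x -> K y -> (dW (pi x) (pi y) <= L * dX x y)%R) /\
    exists C r0 : R, [/\ (1 <= C)%R, (0 < r0)%R &
      forall w r, (0 < r)%R -> (r < r0)%R ->
        exists (n : nat) (c : 'I_n -> X),
          (n%:R <= C * r `^ (- s))%R /\
          (pi @^-1` mball dW w r) `&` K `<=`
             \bigcup_(i in [set: 'I_n]) mball dX (c i) (C * r)].

Definition Lp_loc (disp : measure_display) (X : measurableType disp)
    (d : X -> X -> R) (mu : {measure set X -> \bar R}) (p : R)
    (g : X -> \bar R) : Prop :=
  measurable_fun [set: X] g /\
  forall K : set X, mcompact d K -> \int[mu]_(x in K) (`|g x| `^ p) < +oo.

End MMS.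

(* Main.v *)
Require Import Defs.
From mathcomp Require Import all_boot all_order all_algebra.
From mathcomp Require Import all_classical all_reals all_analysis measurable_realfun.
From mathcomp Require Import ring lra.
Set Implicit Arguments. Unset Strict Implicit. Unset Printing Implicit Defensive.
Import Order.TTheory GRing.Theory Num.Theory.
Local Open Scope classical_set_scope.
Local Open Scope ring_scope.

(** Write [nu B] for the integral of [g ^ p] over [B].  Telescoping averages over
    concentric balls turns the Poincaré inequality into the Morrey estimate
    [diam (f (B x r)) ^ p <= A r ^ (p - Q) nu (B x (Lam r))].  Fix [al] with
    [s < al < alpha] and a compact [K].  If the [al]-dimensional Hausdorff premeasure
    of [f (pi^-1 a `&` K)] is at least [eps], then covering the fiber by at most
    [C r ^ (- s)] balls centered at separated points and comparing exponents [al] and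
    [p] shows that these balls carry [nu]-mass at least [c r ^ b], where
    [b = Q - s - p (1 - s / al)].  For points [a] that are [C r]-separated in [W] the
    resulting balls have bounded overlap in [X], so there are at most [C r ^ (- b)]
    such points.  Hence the set of these [a] has box dimension at most [b]; it remains
    to take the countable union over [K] and [eps] and to let [al] tend to [alpha]. *)

(** * Hausdorff premeasures, finite covers and null sets *)

Section HausdorffNull.
Context {R : realType} {T : Type}.
Variable d : T -> T -> R.
Implicit Types (A E : set T) (t del : R).

Lemma mdiam_ge0 E : (0 <= mdiam d E)%E.
Proof. by apply: ereal_sup_ubound; left. Qed.

Lemma mdiam_le E (D : R) : 0 <= D -> (forall x y, E x -> E y -> d x y <= D) ->
  (mdiam d E <= D%:E)%E.
Proof.
move=> D0 ED; apply: ub_ereal_sup => _ [->|[x Ex [y Ey <-]]]; rewrite lee_fin//.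
exact: ED.
Qed.

Lemma mdiam_fin E del : (mdiam d E <= del%:E)%E -> mdiam d E \is a fin_num.
Proof.
move=> Edel; rewrite ge0_fin_numE ?mdiam_ge0//.
by rewrite (le_lt_trans Edel)// ltry.
Qed.

Lemma mdiam_set0 : mdiam d set0 = 0%E.
Proof. by apply/eqP; rewrite eq_le mdiam_ge0 andbT mdiam_le. Qed.

Lemma hausdorff_delta_ge0 t del A : (0 <= hausdorff_delta d t del A)%E.
Proof.
apply: le_ereal_inf_tmp => _ [E _ <-].
by apply: nneseries_ge0 => *; rewrite lee_fin powR_ge0.
Qed.

Lemma hausdorff_delta_anti t del del' A : del <= del' ->
  (hausdorff_delta d t del' A <= hausdorff_delta d t del A)%E.
Proof.
move=> dd'; apply: ereal_inf_le_tmp => _ [E [AE Edel] <-]; exists E => //.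
by split=> // i; rewrite (le_trans (Edel i))// lee_fin.
Qed.

Lemma hausdorff_delta_sub t del A B : A `<=` B ->
  (hausdorff_delta d t del A <= hausdorff_delta d t del B)%E.
Proof.
move=> AB; apply: ereal_inf_le_tmp => _ [E [BE Edel] <-]; exists E => //.
by split=> //; exact: subset_trans BE.
Qed.

(** The finite cover is padded with empty sets to a sequence. They cost nothing because [0 < t]; at
    exponent 0 each of them would count for 1. *)
Lemma hausdorff_delta_finite_cover t del A (n : nat) (E : 'I_n -> set T)
    (D : 'I_n -> R) : 0 < t -> 0 <= del ->
  A `<=` \bigcup_i E i ->
  (forall i, (mdiam d (E i) <= (D i)%:E)%E) -> (forall i, D i <= del) ->
  (hausdorff_delta d t del A <= (\sum_i D i `^ t)%:E)%E.
Proof.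
move=> t0 del0 AE ED Ddel.
pose F k := if insub k is Some i then E i else set0.
apply: (@le_trans _ _
    (\sum_(0 <= i <oo) ((fine (mdiam d (F i))) `^ t)%:E)%E).
  apply: ereal_inf_lbound; exists F => //; split.
    move=> a /AE[i _ Eia]; exists (val i) => //.
    by rewrite /F insubT //= => ilt; rewrite (_ : Sub _ _ = i)//; apply/val_inj.
  move=> k; rewrite /F; case: insubP => [i _ _|_]; last by rewrite mdiam_set0 lee_fin.
  by rewrite (le_trans (ED i))// lee_fin.
rewrite (nneseries_split _ n) => [|k _]; last by rewrite lee_fin powR_ge0.
rewrite eseries0 => [|k nk _]; last first.
  rewrite /F insubF; last by apply/negbTE; rewrite -leqNgt -(add0n n).
  by rewrite mdiam_set0/= powR0 ?gt_eqF.
rewrite adde0 add0n big_mkord sumEFin lee_fin; apply: ler_sum => i _.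
rewrite /F valK ge0_ler_powR ?nnegrE ?fine_ge0 ?mdiam_ge0 ?(ltW t0)//.
  by rewrite -lee_fin (le_trans (mdiam_ge0 (E i)))// ED.
by rewrite -lee_fin fineK ?ED//; exact: mdiam_fin (ED i).
Qed.

Lemma hausdorff_measure_eq0 t A :
  (forall del, 0 < del -> hausdorff_delta d t del A = 0%E) <->
  hausdorff_measure d t A = 0%E.
Proof.
split=> [H|H del del0].
  apply/eqP; rewrite eq_le; apply/andP; split.
    by apply: ub_ereal_sup => _ [del /= del0 <-]; rewrite H.
  by apply: ereal_sup_ubound; exists 1 => //=; rewrite H.
apply/eqP; rewrite eq_le hausdorff_delta_ge0 andbT -H.
by apply: ereal_sup_ubound; exists del.
Qed.

Lemma hausdorff_measure_sub_eq0 t A B : A `<=` B ->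
  hausdorff_measure d t B = 0%E -> hausdorff_measure d t A = 0%E.
Proof.
move=> AB /hausdorff_measure_eq0 H; apply/hausdorff_measure_eq0 => del del0.
apply/eqP; rewrite eq_le hausdorff_delta_ge0 andbT -(H _ del0).
exact: hausdorff_delta_sub.
Qed.

(** At each scale, [A n] has a cover of total size at most [e / 2 ^ (n + 1)]; these covers are
    merged into a single sequence. *)
Lemma hausdorff_measure_bigcup_eq0 t (A : nat -> set T) :
  (forall n, hausdorff_measure d t (A n) = 0%E) ->
  hausdorff_measure d t (\bigcup_n A n) = 0%E.
Proof.
move=> A0; apply/hausdorff_measure_eq0 => del del0.
apply/eqP; rewrite eq_le hausdorff_delta_ge0 andbT.
apply/lee_addgt0Pr => e e0; rewrite add0e.
pose size (E : nat -> set T) k := ((fine (mdiam d (E k))) `^ t)%:E.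
have size0 (E : nat -> set T) k : (0 <= size E k)%E by rewrite lee_fin powR_ge0.
have /choice[G PG] : forall n, exists E : nat -> set T,
    [/\ A n `<=` \bigcup_i E i, forall i, (mdiam d (E i) <= del%:E)%E &
      (\sum_(0 <= i <oo) size E i <= (e / (2 ^ n.+1)%:R)%:E)%E].
  move=> n; have en : 0 < e / (2 ^ n.+1)%:R.
    by rewrite divr_gt0// ltr0n expn_gt0.
  have /hausdorff_measure_eq0/(_ _ del0) An := A0 n.
  have := @lb_ereal_inf_adherent _ _ _ en.
  move=> /(_ [set (\sum_(0 <= i <oo) size E i)%E | E in [set E : nat -> set T |
      A n `<=` \bigcup_i E i /\ forall i, (mdiam d (E i) <= del%:E)%E]]).
  rewrite -[ereal_inf _]/(hausdorff_delta d t del (A n)) An add0e => /(_ isT).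
  by move=> [_ [E [AE Edel] <-] /ltW]; exists E.
(* A bijection from [nat] to pairs enumerates all pieces of all covers; the double sum is then
   reindexed along it. *)
have /card_esym/ppcard_eqP[f] := card_nat2.
pose F k := G (f k).1 (f k).2.
apply: (@le_trans _ _ (\sum_(0 <= i <oo) size F i)%E).
  apply: ereal_inf_lbound; exists F => //; split.
    move=> x [n _ Anx]; have [AG _ _] := PG n; have [j _ Gx] := AG _ Anx.
    by exists (f^-1%FUN (n, j)) => //; rewrite /F invK ?inE.
  by move=> i; rewrite /F; have [_ + _] := PG (f i).1; exact.
apply: (le_trans _ (@epsilon_trick0 _ e xpredT (ltW e0))).
apply: (@le_trans _ _ (\sum_(0 <= n <oo) \sum_(0 <= i <oo) size (G n) i)%E).
  rewrite nneseries_esumT; last exact: size0.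
  rewrite nneseries_esumT; last by move=> n; apply: nneseries_ge0 => *; exact: size0.
  rewrite [leRHS](eq_esum (b := fun n => \esum_(i in [set: nat]) size (G n) i)%E);
    last by move=> n _; rewrite nneseries_esumT// => k; exact: size0.
  rewrite esum_esum; last by move=> *; exact: size0.
  rewrite (_ : _ `*`` _ = [set: nat * nat]); last by apply/seteqP; split.
  by rewrite (@reindex_esum _ _ _ setT setT f _) //; exact: bijTT.
apply: lee_nneseries => [n _ _|n _].
  by apply: nneseries_ge0 => *; exact: size0.
by have [] := PG n.
Qed.

End HausdorffNull.

(** * Metric axioms and separated families *)

Section Metric.
Context {R : realType} {T : Type} {d : T -> T -> R} (dM : is_metric d).

Lemma metric_ge0 x y : 0 <= d x y.
Proof. by have [+ _] := dM; exact. Qed.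

Lemma metric_xx x : d x x = 0.
Proof. by have [_ [/(_ x x)[_ +] _]] := dM; exact. Qed.

Lemma metricC x y : d x y = d y x.
Proof. by have [_ [_ [+ _]]] := dM; exact. Qed.

Lemma metric_triangle x y z : d x z <= d x y + d y z.
Proof. by have [_ [_ [_ +]]] := dM; exact. Qed.

End Metric.

Section Separated.
Context {R : realType} {T : Type}.
Variable d : T -> T -> R.

(** Indexed families rather than sets: cardinality is read off the index type, and families over
    different fibers combine over a dependent sum. *)
Definition separated (I : eqType) (rho : R) (c : I -> T) : Prop :=
  forall i j, i != j -> rho <= d (c i) (c j).

(** The bound [N] allows a separated family of largest size to be chosen. A point at distance at
    least [rho] from all its members could be added to it, so the family is also a [rho]-net. *)
Lemma maximal_separated (S : set T) (rho : R) (N : nat) : is_metric d ->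
  (forall n (c : 'I_n -> T), (forall i, S (c i)) -> separated rho c ->
    (n <= N)%N) ->
  exists n (c : 'I_n -> T), [/\ forall i, S (c i), separated rho c &
    forall x, S x -> exists i, d (c i) x < rho].
Proof.
move=> [_ [_ [dC _]]] SN.
pose P n := `[< exists c : 'I_n -> T, (forall i, S (c i)) /\ separated rho c >].
have P0 : exists n, P n.
  exists 0%N; apply/asboolP.
  by exists (fun i : 'I_0 => False_rect _ (notF (ltn_ord i))); split=> -[].
have PN n : P n -> (n <= N)%N by move=> /asboolP[c [Sc sc]]; exact: SN Sc sc.
case: (ex_maxnP P0 PN) => n /asboolP[c [Sc sc]] nmax; exists n, c; split=> // x Sx.
apply: contrapT => /forallNP cx.
suff /nmax : P n.+1 by rewrite ltnn.
apply/asboolP; exists (fun i => if unlift ord0 i is Some j then c j else x).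
split=> [i|i j]; first by case: unliftP.
case: unliftP => [i' ->|->]; case: unliftP => [j' ->|->].
- by rewrite (inj_eq lift_inj); exact: sc.
- by move=> _; rewrite leNgt; apply/negP/cx.
- by move=> _; rewrite dC leNgt; apply/negP/cx.
- by rewrite eqxx.
Qed.

(** Two points of one ball of radius [rho] are less than [2 * rho] apart, so sending each [c i] to a
    ball that contains it is injective. *)
Lemma separated_card_le (S : set T) (rho : R) (N : nat) (b : 'I_N -> T)
    (I : finType) (c : I -> T) : is_metric d ->
  S `<=` \bigcup_i mball d (b i) rho -> (forall i, S (c i)) ->
  separated (2 * rho) c -> (#|I| <= N)%N.
Proof.
move=> [_ [_ [dC dtri]]] Sb Sc sc.
have /choice[h hc] : forall i, exists k, d (b k) (c i) < rho.
  by move=> i; have [k _ ?] := Sb _ (Sc i); exists k.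
rewrite -[N in (_ <= N)%N]card_ord; apply: (@leq_card _ _ h) => i j hij.
apply/eqP; apply/negPn/negP => /sc; apply/negP; rewrite -ltNge.
rewrite (le_lt_trans (dtri _ (b (h i)) _))// mulr_natl mulr2n ltrD//.
  by rewrite dC hc.
by rewrite hij hc.
Qed.

End Separated.

(** The sum of the indicators of the [B i] is at most [N] on [D]; it remains to integrate against
    [h]. The constant [h = 1] gives packing bounds, the power of the upper gradient gives energy
    bounds. *)
Lemma sum_integral_le_overlap (R : realType) (disp : measure_display)
    (X : measurableType disp) (mu : {measure set X -> \bar R}) (I : Type)
    (s : seq I) (B : I -> set X) (D : set X) (h : X -> \bar R) (N : nat) :
  measurable D -> (forall i, measurable (B i)) -> (forall i, B i `<=` D) ->
  measurable_fun D h -> (forall x, D x -> 0 <= h x)%E ->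
  (forall x, D x -> (count (fun i => x \in B i) s <= N)%N) ->
  (\sum_(i <- s) \int[mu]_(x in B i) h x <= N%:R%:E * \int[mu]_(x in D) h x)%E.
Proof.
move=> mD mB BD mh h0 sN.
have mhB i : measurable_fun D (h \_ (B i)).
  by apply/measurable_restrict => //; apply: measurable_funS mh => // x [].
have hB0 i x : D x -> (0 <= (h \_ (B i)) x)%E.
  by move=> _; apply: erestrict_ge0 => y /BD; exact: h0.
under eq_bigr => i _.
  rewrite -[B i](setIidr (@BD i)) integral_mkcondr.
  over.
rewrite -ge0_integral_sum// -ge0_integralZl_EFin//.
apply: ge0_le_integral => //.
- by move=> x Dx; apply: sume_ge0 => i _; exact: hB0.
- exact: emeasurable_sum.
- by apply: measurable_funeM.
move=> x Dx; apply: (@le_trans _ _ ((count (fun i => x \in B i) s)%:R%:E * h x)%E).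
  elim: s {sN} => [|i s IH]; first by rewrite big_nil mul0e.
  rewrite big_cons/= natrD EFinD ge0_muleDl ?lee_fin//; apply: leeD => //.
  by rewrite patchE; case: ifP => _; rewrite ?mul1e ?mul0e.
by apply: lee_wpmul2r; [exact: h0|rewrite lee_fin ler_nat sN].
Qed.

(** * Balls in proper metric measure spaces: measurability, doubling, lower mass bounds, overlap *)

Section ProperMMS.
Context {R : realType} {disp : measure_display} {X : measurableType disp}.
Variables (d : X -> X -> R) (mu : {measure set X -> \bar R}).
Hypothesis mms : proper_mms d mu.

Let dM : is_metric d. Proof. by case: mms. Qed.
Let dxx := metric_xx dM.
Let dC := metricC dM.
Let dtri := metric_triangle dM.

Lemma mball_center x r : 0 < r -> mball d x r x.
Proof. by rewrite /mball/= dxx. Qed.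

Lemma sub_mball x y r r' : d y x + r <= r' -> mball d x r `<=` mball d y r'.
Proof.
move=> rr' z; rewrite /mball/= => xz; rewrite (le_lt_trans (dtri _ x _))//.
by rewrite (lt_le_trans _ rr')// ltrD2l.
Qed.

Lemma mopen_mball x r : mopen d (mball d x r).
Proof.
move=> y; rewrite /mball/= => xy; exists (r - d x y); first by rewrite subr_gt0.
by apply: sub_mball; rewrite addrC subrK.
Qed.

Lemma mopen_measurable U : mopen d U -> measurable U.
Proof. by move=> oU; case: mms => _ _ -> _; exact: sub_sigma_algebra. Qed.

Lemma measurable_mball x r : measurable (mball d x r).
Proof. exact/mopen_measurable/mopen_mball. Qed.

Lemma measurable_mcball x r : measurable (mcball d x r).
Proof.
rewrite -[mcball d x r]setCK; apply: measurableC; apply: mopen_measurable => y.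
rewrite /mcball/= => /negP; rewrite -ltNge => ry.
exists (d x y - r); first by rewrite subr_gt0.
move=> z; rewrite /mball/= => yz; apply/negP; rewrite -ltNge.
by have := dtri x z y; rewrite (dC z y); lra.
Qed.

Lemma mcontinuous_measurable (u : X -> R) :
  mcontinuous d (fun a b => `|a - b|) u -> measurable_fun setT u.
Proof.
move=> cu _; apply: (measurability _ (RGenOInfty.measurableE R)) => //.
move=> _ [_ [a ->] <-]; rewrite setTI; apply: mopen_measurable => x.
rewrite /= in_itv/= andbT => ax.
have [|del del0 H] := cu x (u x - a); first by rewrite subr_gt0.
exists del => // y /H; rewrite /= in_itv/= andbT ltr_norml => /andP[_].
lra.
Qed.

Lemma mu_mball_fin x r : mu (mball d x r) \is a fin_num.
Proof.
have [r0|r0] := pselect (mball d x r !=set0).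
  have [_ _ _ /(_ _ (@mopen_mball x r) r0)/andP[_ ?]] := mms.
  by rewrite ge0_fin_numE.
by rewrite (_ : mball d x r = set0) ?measure0//; apply/eqP/negPn/negP => /set0P.
Qed.

Lemma mu_mball_gt0 x r : 0 < r -> 0 < fine (mu (mball d x r)).
Proof.
move=> r0; rewrite fine_gt0//.
by have [_ _ _ ->] := mms; [by []|exact: mopen_mball|exists x; exact: mball_center].
Qed.

Lemma le_mu_mball x r y r' : mball d x r `<=` mball d y r' ->
  fine (mu (mball d x r)) <= fine (mu (mball d y r')).
Proof.
move=> xy; rewrite fine_le ?mu_mball_fin// le_measure ?inE//; exact: measurable_mball.
Qed.

Section Homogeneous.
Variable Q : R.
Hypothesis (hom : locally_homogeneous d mu Q).

(** Homogeneity between the radii [r] and [l * r], cleared of denominators and moved to real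
    numbers. *)
Lemma mball_doubling K : mcompact d K -> exists Rad C : R, [/\ 0 < Rad, 1 <= C &
  forall x r l, K x -> 0 < r -> 1 <= l -> l * r < Rad ->
    fine (mu (mball d x (l * r))) <= C * l `^ Q * fine (mu (mball d x r))].
Proof.
move=> /hom[Rad [C [Rad0 C1 H]]]; exists Rad, C; split=> // x r l Kx r0 l1 lr.
have rlr : r <= l * r by rewrite ler_peMl// ltW.
have l0 : 0 < l by rewrite (lt_le_trans _ l1).
have := H x r (l * r) Kx r0 rlr lr.
rewrite -(fineK (mu_mball_fin x (l * r))) -(fineK (mu_mball_fin x r)) -!EFinM lee_fin.
rewrite powRM ?(ltW l0) ?(ltW r0)// invfM mulrA ler_pdivrMr ?powR_gt0//.
rewrite -!mulrA mulVf ?gt_eqF ?powR_gt0// mulr1 ler_pdivrMr ?powR_gt0//.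
by rewrite -mulrA [X in _ -> _ <= C * X]mulrC.
Qed.

(** Doubling compares a small ball with the concentric ball of radius [Rad / 2], and compactness of
    [K] bounds the mass of the latter from below uniformly in the center. *)
Lemma mball_lower_mass K : mcompact d K -> exists Rad c : R, [/\ 0 < Rad, 0 < c &
  forall x r, K x -> 0 < r -> r < Rad -> c * r `^ Q <= fine (mu (mball d x r))].
Proof.
move=> cK; have [Rad [C [Rad0 C1 H]]] := mball_doubling cK.
have C0 : 0 < C by rewrite (lt_le_trans _ C1).
(* The mass of a ball need not depend continuously on its center. Points close to the center of a
   heavy ball form an open set instead, and [B(z, Rad / 4)] lies in [B(x, Rad / 2)] for such a point
   [x]. *)
pose U (k : nat) := [set y | exists2 z, k.+1%:R^-1 < fine (mu (mball d z (Rad / 4)))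
                             & mball d z (Rad / 4) y].
have [|x Kx|F finF KF] := cK _ U.
- move=> k y [z kz zy]; have [r r0 yz] := mopen_mball zy.
  by exists r => // y' /yz; exists z.
- have x0 : 0 < fine (mu (mball d x (Rad / 4))) by rewrite mu_mball_gt0// divr_gt0.
  exists (Num.bound (fine (mu (mball d x (Rad / 4))))^-1) => //.
  exists x; last by apply: mball_center; rewrite divr_gt0.
  rewrite invf_plt ?posrE ?ltr0n//.
  apply: (@lt_trans _ _ (Num.bound (fine (mu (mball d x (Rad / 4))))^-1)%:R).
    by apply: archi_boundP; rewrite invr_ge0 ltW.
  by rewrite ltr_nat.
pose M := (\max_(k <- finmap.enum_fset (fset_set F)) k)%N.
have FM k : F k -> (k <= M)%N.
  by move=> Fk; apply: leq_bigmax_seq => //; rewrite in_fset_set// inE.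
exists (Rad / 2), (M.+1%:R^-1 / (C * (Rad / 2) `^ Q)); split.
- by rewrite divr_gt0.
- by rewrite divr_gt0 ?invr_gt0// mulr_gt0// powR_gt0// divr_gt0.
move=> x r Kx r0 rRad.
have [k Fk [z kz zx]] := KF _ Kx.
have Mx : M.+1%:R^-1 <= fine (mu (mball d x (Rad / 2))).
  apply: (@le_trans _ _ k.+1%:R^-1); first by rewrite lef_pV2 ?posrE// ler_nat ltnS FM.
  rewrite (le_trans (ltW kz))// le_mu_mball//; apply: sub_mball.
  by move: zx; rewrite /mball/= dC; lra.
have l1 : 1 <= (Rad / 2) / r by rewrite ler_pdivlMr// mul1r ltW.
have l0 : 0 < (Rad / 2) / r by rewrite (lt_le_trans _ l1).
have lr : (Rad / 2) / r * r = Rad / 2 by rewrite divfK// gt_eqF.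
have := H x r ((Rad / 2) / r) Kx r0 l1; rewrite lr => /(_ ltac:(lra)) Hx.
rewrite -[in (Rad / 2) `^ Q]lr powRM ?(ltW l0) ?(ltW r0)//.
rewrite !invfM !mulrA mulrVK ?unitfE ?gt_eqF ?powR_gt0//.
rewrite -mulrA -invfM ler_pdivrMr ?mulr_gt0 ?powR_gt0//.
by rewrite (le_trans Mx)// (le_trans Hx)// mulrC.
Qed.

(** If [y] lies in several of the enlarged balls, the corresponding balls of radius [rho] are
    disjoint, lie in one ball [D] of comparable radius and each carry at least the fraction [1 / A]
    of its mass. There are thus at most [A] of them. *)
Lemma bounded_overlap K (Lam : R) : mcompact d K -> 1 <= Lam ->
  exists (Rad : R) (N : nat), 0 < Rad /\
  forall (I : finType) (z : I -> X) (rho : R), 0 < rho -> rho < Rad ->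
    (forall i, K (z i)) -> separated d (2 * rho) z ->
    forall y, (count (fun i => y \in mball d (z i) (Lam * rho)) (index_enum I) <= N)%N.
Proof.
move=> cK L1; have [Rad [C [Rad0 C1 H]]] := mball_doubling cK.
have C0 : 0 < C by rewrite (lt_le_trans _ C1).
(* Centers of two enlarged balls through [y] are less than [2 * Lam * rho] apart, so [D], of radius
   [(2 * Lam + 1) * rho], lies in the ball of radius [l * rho] about either center. *)
pose l := 4 * Lam + 1.
have l0 : 0 < l by rewrite /l; lra.
pose A := C * l `^ Q; have A0 : 0 < A by rewrite mulr_gt0// powR_gt0.
exists (Rad / l), (Num.bound A); split; first by rewrite divr_gt0.
move=> I z rho rho0 rhoRad Kz sz y.
set s := [seq i <- index_enum I | y \in mball d (z i) (Lam * rho)].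
rewrite -size_filter -/s.
case E: s => [//|i0 s']; rewrite -E.
have zs i : i \in s -> d (z i) y < Lam * rho by rewrite mem_filter => /andP[/set_mem].
have zi0 : d (z i0) y < Lam * rho by apply: zs; rewrite E mem_head.
pose D := mball d (z i0) ((2 * Lam + 1) * rho).
have Dm : forall i, i \in s -> fine (mu D) <= A * fine (mu (mball d (z i) rho)).
  move=> i /zs zi; apply: (@le_trans _ _ (fine (mu (mball d (z i) (l * rho))))).
    apply: le_mu_mball; apply: sub_mball; rewrite /l.
    by have := dtri (z i) y (z i0); rewrite (dC y); lra.
  apply: H => //; first by rewrite /l; lra.
  by rewrite mulrC -ltr_pdivlMr.
(* Made empty off [s] so that the inclusion in [D] holds for every index. *)
pose B i := if i \in s then mball d (z i) rho else set0.
have mB i : measurable (B i).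
  by rewrite /B; case: ifP => _; [exact: measurable_mball|exact: measurable0].
have BD i : B i `<=` D.
  rewrite /B; case: ifP => [/zs zi|_]; last exact: sub0set.
  apply: sub_mball.
  by have := dtri (z i0) y (z i); rewrite (dC y); lra.
have := @sum_integral_le_overlap R _ X mu I s B D (cst 1%E) 1 (measurable_mball _ _)
  mB BD (measurable_cst _) (fun _ _ => lee01).
rewrite integral_cst ?mul1e; last exact: measurable_mball.
have cnt x : D x -> (count (fun i => x \in B i) s <= 1)%N.
  move=> Dx; rewrite -size_filter; set s1 := (X in size X).
  have us1 : uniq s1 by rewrite !filter_uniq// index_enum_uniq.
  have sub i j : i \in s1 -> j \in s1 -> i = j.
    rewrite !(mem_filter _ _ s) => /andP[/set_mem + is_] /andP[/set_mem + js].
    rewrite /B is_ js /mball/= => ix jx; apply/eqP/negPn/negP => /sz.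
    by have := dtri (z i) x (z j); rewrite (dC x); lra.
  case: s1 us1 sub => [|i [|j s1]]//= /andP[+ _] sub.
  by rewrite (sub i j) ?inE ?eqxx ?orbT.
move=> /(_ cnt); under eq_bigr do rewrite integral_cst// mul1e.
have -> : (\sum_(i <- s) mu (B i) = (\sum_(i <- s) fine (mu (mball d (z i) rho)))%:E)%E.
  rewrite -sumEFin; apply: eq_big_seq => i si.
  by rewrite /B si fineK// mu_mball_fin.
rewrite -(fineK (mu_mball_fin _ _)) lee_fin => sumD.
have D0 : 0 < fine (mu D) by apply: mu_mball_gt0; rewrite mulr_gt0//; lra.
rewrite -(ler_nat R); apply: ltW; apply: le_lt_trans (archi_boundP (ltW A0)).
rewrite -(ler_pM2r D0).
apply: (@le_trans _ _ (A * \sum_(i <- s) fine (mu (mball d (z i) rho)))); last first.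
  by rewrite ler_pM2l.
rewrite mulr_sumr.
have -> : (size s)%:R * fine (mu D) = \sum_(i <- s) fine (mu D).
  by rewrite big_const_seq count_predT iter_addr_0 mulr_natl.
by rewrite big_seq [leRHS]big_seq; apply: ler_sum => i; exact: Dm.
Qed.
End Homogeneous.
End ProperMMS.

(** * Averages of continuous functions over balls *)

Section Averages.
Context {R : realType} {disp : measure_display} {X : measurableType disp}.
Variables (d : X -> X -> R) (mu : {measure set X -> \bar R}).
Hypothesis mms : proper_mms d mu.

Let dM : is_metric d. Proof. by case: mms. Qed.

Variable u : X -> R.
Hypothesis cu : mcontinuous d (fun a b => `|a - b|) u.

Let avg (B : set X) := (fine (mu B))^-1 * \int[mu]_(y in B) u y.

Lemma mcontinuous_bounded K : mcompact d K -> exists M, forall x, K x -> `|u x| <= M.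
Proof.
move=> cK; pose U (k : nat) := [set y | `|u y| < k%:R].
have [k x|x Kx|F finF KF] := cK _ U.
- rewrite /U/= => kx; have [|del del0 H] := @cu x (k%:R - `|u x|).
    by rewrite subr_gt0.
  exists del => // y /H/=; rewrite distrC => yx.
  by have := ler_normD (u y - u x) (u x); rewrite subrK; lra.
- by exists (Num.bound `|u x|) => //; apply: archi_boundP.
exists (\max_(k <- finmap.enum_fset (fset_set F)) k)%N%:R => x /KF[k Fk]/ltW/le_trans; apply.
by rewrite ler_nat; apply: leq_bigmax_seq => //; rewrite in_fset_set// inE.
Qed.

(** Properness puts the ball inside a compact closed ball, on which the continuous [u] is
    bounded. *)
Lemma integrable_mball_center x r c :
  mu.-integrable (mball d x r) (EFin \o (fun y => u y - c)).
Proof.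
apply: measurable_bounded_integrable.
- exact: measurable_mball mms _ _.
- by rewrite -ge0_fin_numE// (mu_mball_fin mms).
- apply: measurable_funB => //; apply: measurable_funTS.
  exact: mcontinuous_measurable mms _ cu.
have [_ /(_ x r)/mcontinuous_bounded[M HM] _ _] := mms.
exists (M + `|c|); split; first exact: num_real.
move=> M' MM' y /= xy; rewrite (le_trans (ler_normB _ _))//.
by rewrite (le_trans _ (ltW MM'))// lerD2r HM//; exact: ltW.
Qed.

Lemma integrable_mball x r : mu.-integrable (mball d x r) (EFin \o u).
Proof.
have := integrable_mball_center x r 0; congr (_.-integrable _ _).
by apply/funext => y /=; rewrite subr0.
Qed.

Lemma avg_sub_le x r c : 0 < r ->
  `|avg (mball d x r) - c| <=
    (fine (mu (mball d x r)))^-1 * \int[mu]_(y in mball d x r) `|u y - c|.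
Proof.
move=> r0; have m0 := mu_mball_gt0 mms x r0.
have mB := measurable_mball mms x r.
have -> : avg (mball d x r) - c =
    (fine (mu (mball d x r)))^-1 * \int[mu]_(y in mball d x r) (u y - c).
  rewrite RintegralB//; [|exact: integrable_mball|].
    by rewrite Rintegral_cst// mulrBr [c * _]mulrC mulKf ?gt_eqF.
  apply: measurable_bounded_integrable => //.
    by rewrite -ge0_fin_numE// (mu_mball_fin mms).
  by exists `|c|; split; [exact: num_real|move=> M /ltW ? ? ?].
rewrite normrM ger0_norm ?invr_ge0 ?(ltW m0)// ler_pM2l ?invr_gt0//.
by apply: le_normr_Rintegral => //; exact: integrable_mball_center.
Qed.

(** The integral of the deviation from the larger average only grows when the domain is enlarged;
    changing the normalization costs the ratio of the masses. *)
Lemma avg_mean_osc x r y r' E : 0 < r -> 0 < r' -> mball d x r `<=` mball d y r' ->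
  (mean_osc mu (mball d y r') u <= E%:E)%E ->
  `|avg (mball d x r) - avg (mball d y r')| <=
    fine (mu (mball d y r')) / fine (mu (mball d x r)) * E.
Proof.
move=> r0 r'0 xy; rewrite /mean_osc -/(avg (mball d y r')).
set c := avg (mball d y r') => oscE.
have m0 := mu_mball_gt0 mms x r0; have m'0 := mu_mball_gt0 mms y r'0.
have mB := measurable_mball mms.
apply: (le_trans (avg_sub_le x c r0)); rewrite mulrC mulrAC ler_pM2r ?invr_gt0//.
have in' := integrable_norm (integrable_mball_center y r' c).
apply: (@le_trans _ _ (\int[mu]_(z in mball d y r') `|u z - c|)).
  rewrite fine_le ?(integrable_fin_num _ in')//.
    by apply: (@integrable_fin_num) => //; exact: integrable_norm (integrable_mball_center _ _ _).
  apply: ge0_subset_integral => //; apply/measurable_EFinP; case/integrableP: in' => + _.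
  by move/measurable_EFinP.
move: oscE; rewrite -[(\int[mu]_(_ in _) _)%E]fineK ?(integrable_fin_num _ in')//.
by rewrite -EFinM lee_fin mulrC ler_pdivrMr// mulrC.
Qed.

Lemma avg_cvg_center x e : 0 < e -> exists2 del, 0 < del &
  forall r, 0 < r -> r < del -> `|avg (mball d x r) - u x| <= e.
Proof.
move=> e0; have [del del0 H] := cu x e0; exists del => // r r0 rdel.
have m0 := mu_mball_gt0 mms x r0.
apply: (le_trans (avg_sub_le x (u x) r0)).
rewrite mulrC ler_pdivrMr//.
have mB := measurable_mball mms x r.
rewrite -Rintegral_cst//; apply: le_Rintegral => //.
- exact: integrable_norm (integrable_mball_center _ _ _).
- apply: measurable_bounded_integrable => //.
    by rewrite -ge0_fin_numE// (mu_mball_fin mms).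
  by exists `|e|; split; [exact: num_real|move=> M /ltW ? ? ?].
by move=> y /= xy; rewrite distrC ltW// H// (lt_trans xy).
Qed.

End Averages.

(** * Comparison of powers by a threshold *)

Section PowerThreshold.
Context {R : realType}.

(** The first term dominates for [y <= t]. For [y > t] the second does, since the exponent [a - p]
    is negative. It serves both for integrals and for finite sums of diameters. *)
Lemma powR_threshold (y t a p : R) : 0 <= y -> 0 < t -> 0 < a -> a < p ->
  y `^ a <= t `^ a + t `^ (a - p) * y `^ p.
Proof.
move=> y0 t0 a0 ap; have [yt|ty] := leP y t.
  rewrite -[leLHS]addr0 lerD ?mulr_ge0 ?powR_ge0//.
  by rewrite ge0_ler_powR ?nnegrE// ltW.
have yp : 0 < y by exact: lt_trans ty.
rewrite -[leLHS]add0r lerD ?powR_ge0//.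
have -> : y `^ a = y `^ (a - p) * y `^ p.
  by rewrite -powRD ?subrK// (gt_eqF yp) implybT.
rewrite ler_pM2r ?powR_gt0//.
rewrite -opprB !powRN lef_pV2 ?posrE ?powR_gt0//.
by rewrite ge0_ler_powR ?nnegrE ?subr_ge0 ?(ltW ap) ?(ltW t0) ?(ltW yp) ?(ltW ty).
Qed.

Lemma poweR_threshold (y : \bar R) (t a p : R) : (0 <= y)%E -> 0 < t -> 0 < a -> a < p ->
  (y `^ a <= (t `^ a)%:E + (t `^ (a - p))%:E * y `^ p)%E.
Proof.
move=> y0 t0 a0 ap; case: y y0 => [y| |]//.
  by rewrite !lee_fin => y0; exact: powR_threshold.
have p0 : 0 < p := lt_trans a0 ap.
by move=> _; rewrite !poweRyr ?gt_eqF// gt0_muley ?lte_fin ?powR_gt0// addey.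
Qed.

(* A threshold replaces Hölder's inequality, at the cost of the factor 2. *)
Lemma avg_poweR_le (disp : measure_display) (X : measurableType disp)
    (mu : {measure set X -> \bar R}) (D : set X) (g : X -> \bar R) (Q p t : R) :
  measurable D -> mu D \is a fin_num -> 0 < fine (mu D) ->
  measurable_fun D g -> (forall x, 0 <= g x)%E -> 1 <= Q -> Q < p -> 0 < t ->
  (\int[mu]_(x in D) (g x `^ p) <= (t `^ p * fine (mu D))%:E)%E ->
  ((((fine (mu D))^-1)%:E * \int[mu]_(x in D) (g x `^ Q)) `^ Q^-1 <= (2 * t)%:E)%E.
Proof.
move=> mD Dfin m0 mg g0 Q1 Qp t0 gp; set m := fine (mu D).
have Q0 : 0 < Q by rewrite (lt_le_trans _ Q1).
have mgp a : measurable_fun D (fun x => g x `^ a)%E.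
  exact: (measurableT_comp (measurable_poweR a) mg).
(* Each of the two terms of the threshold bound contributes at most [t ^ Q * m], and
   [2 * t ^ Q <= (2 * t) ^ Q] because [1 <= Q]. *)
have gQ : (\int[mu]_(x in D) (g x `^ Q) <= ((2 * t) `^ Q * m)%:E)%E.
  apply: (@le_trans _ _ (\int[mu]_(x in D) ((t `^ Q)%:E + (t `^ (Q - p))%:E * g x `^ p))%E).
    apply: ge0_le_integral => //.
    - by move=> *; exact: poweR_ge0.
    - by apply: emeasurable_funD => //; exact: measurable_funeM.
    - by move=> x _; exact: poweR_threshold.
  rewrite ge0_integralD//.
  - rewrite ge0_integralZl_EFin ?powR_ge0//; last by move=> *; exact: poweR_ge0.
    rewrite integral_cst// -(fineK Dfin) -/m -EFinM.
    apply: (@le_trans _ _ ((t `^ Q * m)%:E + (t `^ (Q - p))%:E * (t `^ p * m)%:E)%E).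
      by rewrite leeD2l// lee_wpmul2l// lee_fin powR_ge0.
    rewrite -EFinM -EFinD lee_fin mulrA -powRD ?(gt_eqF t0) ?implybT// subrK.
    rewrite powRM ?(ltW t0)// -mulrDl ler_wpM2r ?(ltW m0)//.
    rewrite (_ : t `^ Q + t `^ Q = 2 * t `^ Q); last by ring.
    rewrite ler_wpM2r ?powR_ge0// -[leLHS](@powRr1 _ 2)//.
    by apply: ler_powR => //; rewrite ler1n.
  - by move=> *; rewrite lee_fin powR_ge0.
  - by move=> *; rewrite mule_ge0 ?poweR_ge0// lee_fin powR_ge0.
  - exact: measurable_funeM.
have -> : (2 * t)%:E = (((2 * t) `^ Q)%:E `^ Q^-1)%E.
  by rewrite poweR_EFin -powRrM mulfV ?gt_eqF// powRr1// mulr_ge0// ltW.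
apply: gt0_ler_poweR; rewrite ?invr_ge0 ?(ltW Q0)//.
- rewrite in_itv/= leey andbT mule_ge0 ?lee_fin ?invr_ge0 ?(ltW m0)//.
  by apply: integral_ge0 => *; exact: poweR_ge0.
- by rewrite in_itv/= leey andbT lee_fin powR_ge0.
apply: (@le_trans _ _ ((m^-1)%:E * ((2 * t) `^ Q * m)%:E)%E).
  by rewrite lee_wpmul2l// lee_fin invr_ge0 ltW.
by rewrite -EFinM lee_fin mulrC mulfK// gt_eqF.
Qed.

End PowerThreshold.

(** * Morrey's estimate from the Poincaré inequality *)

Section Morrey.
Context {R : realType} {disp : measure_display} {X : measurableType disp}.
Variables (d : X -> X -> R) (mu : {measure set X -> \bar R}) (Q p : R).
Hypotheses (mms : proper_mms d mu) (hom : locally_homogeneous d mu Q)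
  (poinc : local_poincare d mu Q) (Q1 : 1 <= Q) (Qp : Q < p).

Let dM : is_metric d. Proof. by case: mms. Qed.
Let Q0 : 0 < Q. Proof. exact: lt_le_trans Q1. Qed.
Let p0 : 0 < p. Proof. exact: lt_trans Qp. Qed.
(** The Hölder exponent of the Morrey embedding, positive because [Q < p]. *)
Let gam := 1 - Q / p.
Let gam0 : 0 < gam. Proof. by rewrite subr_gt0 ltr_pdivrMr// mul1r. Qed.

Let avg (u : X -> R) (B : set X) := (fine (mu B))^-1 * \int[mu]_(y in B) u y.

(** In the Poincaré inequality the diameter gives a factor [r], and passing from the [Q]-mean to the
    [p]-mean with the lower mass bound gives [r ^ (- Q / p)]. The energy enters through a positive
    bound [T], since the threshold must be positive. *)
Lemma mean_osc_le K : mcompact d K -> exists A sig Rad : R,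
  [/\ 0 < A, 1 <= sig, 0 < Rad &
  forall (u : X -> R) (g : X -> \bar R),
    mcontinuous d (fun a b : R => `|a - b|) u ->
    upper_gradient d (fun a b : R => `|a - b|) u g ->
  forall x r T, K x -> 0 < r -> r < Rad -> 0 < T ->
    (\int[mu]_(y in mball d x (sig * r)) (g y `^ p) <= T%:E)%E ->
    (mean_osc mu (mball d x r) u <= (A * r `^ gam * T `^ p^-1)%:E)%E].
Proof.
move=> cK; have [C [sig [RP [C1 sig1 RP0 H]]]] := poinc cK.
have [RL [c [RL0 c0 HL]]] := mball_lower_mass mms hom cK.
have C0 : 0 < C by rewrite (lt_le_trans _ C1).
have sig0 : 0 < sig by rewrite (lt_le_trans _ sig1).
exists (4 * C * (c `^ p^-1)^-1), sig, (Num.min RP (RL / sig)); split=> //.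
- by rewrite mulr_gt0 ?invr_gt0 ?powR_gt0// mulr_gt0.
- by rewrite lt_min RP0 divr_gt0.
move=> u g cu ug x r T Kx r0; rewrite lt_min => /andP[rP rL] T0 gT.
apply: (le_trans (H u g cu ug x r Kx r0 rP)).
have sr0 : 0 < sig * r by rewrite mulr_gt0.
have [mg g0 _] := ug.
(* Chosen so that [t ^ p] times the lower mass bound [c * r ^ Q] equals [T]. *)
pose t := (T / (c * r `^ Q)) `^ p^-1.
have rQ0 : 0 < r `^ Q by rewrite powR_gt0.
have cr0 : 0 < c * r `^ Q by rewrite mulr_gt0.
have t0 : 0 < t by rewrite powR_gt0// divr_gt0.
have tp : t `^ p = T / (c * r `^ Q).
  by rewrite -powRrM mulVf ?gt_eqF// powRr1// ltW// divr_gt0.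
have := @avg_poweR_le R _ X mu (mball d x (sig * r)) g Q p t
  (measurable_mball mms _ _) (mu_mball_fin mms _ _) (mu_mball_gt0 mms _ sr0)
  (measurable_funTS mg) g0 Q1 Qp t0.
have -> : 4 * C * (c `^ p^-1)^-1 * r `^ gam * T `^ p^-1 = C * (2 * r) * (2 * t).
  rewrite /t powRM ?(ltW T0) ?invr_ge0 ?(ltW cr0)//.
  rewrite -[in (c * r `^ Q)^-1 `^ _](powR_inv1 (ltW cr0)) -powRrM mulrC.
  rewrite mulN1r powRN powRM ?(ltW c0) ?(ltW rQ0)// -powRrM invfM.
  rewrite /gam powRB ?(gt_eqF r0) ?implybT// powRr1 ?(ltW r0)//.
  by rewrite -[Q / p]/(Q * p^-1); ring.
move=> Hle; rewrite [X in (_ <= X)%E]EFinM; apply: lee_pmul.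
- by rewrite mule_ge0 ?mdiam_ge0// lee_fin ltW.
- exact: poweR_ge0.
- rewrite EFinM lee_wpmul2l ?lee_fin ?(ltW C0)//; apply: mdiam_le.
    by rewrite mulr_ge0// ltW.
  move=> y z; rewrite /mball/= => xy xz.
  by have := metric_triangle dM y x z; rewrite (metricC dM y x); lra.
apply: Hle; apply: (le_trans gT); rewrite tp lee_fin.
have rsr : r <= sig * r by rewrite ler_peMl// ltW.
rewrite mulrAC ler_pdivlMr// ler_pM2l//.
apply: (le_trans _ (HL x (sig * r) Kx sr0 _)); last by rewrite mulrC -ltr_pdivlMr.
rewrite ler_pM2l// ge0_ler_powR ?nnegrE ?(ltW Q0) ?(ltW r0)//; exact: ltW.
Qed.

Let integral_mball_sub (g : X -> \bar R) x r y r' :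
  measurable_fun setT g -> mball d x r `<=` mball d y r' ->
  (\int[mu]_(z in mball d x r) (g z `^ p) <=
   \int[mu]_(z in mball d y r') (g z `^ p))%E.
Proof.
move=> mg xy; apply: ge0_subset_integral => //; try exact: measurable_mball mms _ _.
- apply: measurable_funTS; exact: (measurableT_comp (measurable_poweR p) mg).
- by move=> *; exact: poweR_ge0.
Qed.

(** Averages over the balls of radius [r / 2 ^ n] tend to [u x] by continuity, and their successive
    differences are dominated by a geometric series of ratio [th]. *)
Lemma center_avg_le K : mcompact d K -> exists A sig Rad : R,
  [/\ 0 < A, 1 <= sig, 0 < Rad &
  forall (u : X -> R) (g : X -> \bar R),
    mcontinuous d (fun a b : R => `|a - b|) u ->
    upper_gradient d (fun a b : R => `|a - b|) u g ->
  forall x r T, K x -> 0 < r -> r < Rad -> 0 < T ->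
    (\int[mu]_(y in mball d x (sig * r)) (g y `^ p) <= T%:E)%E ->
    `|u x - avg u (mball d x r)| <= A * r `^ gam * T `^ p^-1].
Proof.
move=> cK; have [A0 [sig [R0 [A00 sig1 R00 Hosc]]]] := mean_osc_le cK.
have [Rd [Cd [Rd0 Cd1 Hd]]] := mball_doubling mms hom cK.
have Cd0 : 0 < Cd by rewrite (lt_le_trans _ Cd1).
pose th : R := 2^-1 `^ gam.
have th0 : 0 <= th by exact: powR_ge0.
have th1 : th < 1.
  rewrite /th [ltRHS](_ : 1 = 1 `^ gam); last by rewrite /powR oner_eq0 ln1 mulr0 expR0.
  by apply: gt0_ltr_powR; rewrite ?nnegrE//; lra.
(* The factor [Cd * 2 ^ Q] bounds the mass of a ball relative to the concentric ball of half the
   radius. *)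
pose A1 := Cd * 2 `^ Q * A0.
have A10 : 0 < A1 by rewrite mulr_gt0// mulr_gt0// powR_gt0.
exists (A1 / (1 - th)), sig, (Num.min R0 Rd); split=> //.
- by rewrite divr_gt0// subr_gt0.
- by rewrite lt_min R00.
move=> u g cu ug x r T Kx r0; rewrite lt_min => /andP[rR0 rRd] T0 gT.
have [mg g0 _] := ug.
pose b t := mball d x t.
have step t : 0 < t -> t <= r ->
    `|avg u (b (t / 2)) - avg u (b t)| <= A1 * t `^ gam * T `^ p^-1.
  move=> t0 tr; have t20 : 0 < t / 2 by rewrite divr_gt0.
  have bb : b (t / 2) `<=` b t.
    by apply: (sub_mball mms); rewrite (metric_xx dM); lra.
  have tE : (mean_osc mu (b t) u <= (A0 * t `^ gam * T `^ p^-1)%:E)%E.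
    apply: (Hosc u g) => //; first exact: le_lt_trans rR0.
    apply: le_trans gT; apply: integral_mball_sub => //.
    apply: (sub_mball mms); rewrite (metric_xx dM) add0r ler_wpM2l//; lra.
  apply: (le_trans (avg_mean_osc mms cu t20 t0 bb tE)).
  rewrite (_ : A1 * _ * _ = Cd * 2 `^ Q * (A0 * t `^ gam * T `^ p^-1)); last first.
    by rewrite /A1; ring.
  apply: ler_wpM2r; first by rewrite mulr_ge0 ?powR_ge0// mulr_ge0 ?powR_ge0// ltW.
  rewrite ler_pdivrMr ?(mu_mball_gt0 mms)//.
  have := Hd x (t / 2) 2 Kx t20; rewrite mulrC divfK//.
  by apply; [lra|exact: le_lt_trans rRd].
have pow_half n : (r / 2 ^+ n) `^ gam = r `^ gam * th ^+ n.
  elim: n => [|n IH]; first by rewrite !expr0 divr1 mulr1.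
  rewrite exprSr invfM mulrA powRM ?invr_ge0// ?IH ?exprSr ?mulrA//.
  by rewrite divr_ge0 ?(ltW r0)// exprn_ge0.
pose S := A1 / (1 - th) * r `^ gam * T `^ p^-1.
have tele n : `|avg u (b (r / 2 ^+ n)) - avg u (b r)| <= (1 - th ^+ n) * S.
  elim: n => [|n IH]; first by rewrite expr0 divr1 !subrr normr0 mul0r.
  have rn0 : 0 < r / 2 ^+ n by rewrite divr_gt0// exprn_gt0.
  have rnr : r / 2 ^+ n <= r.
    by rewrite ler_pdivrMr ?exprn_gt0// ler_peMr ?(ltW r0)// exprn_ege1// ler1n.
  have -> : (1 - th ^+ n.+1) * S =
      A1 * (r / 2 ^+ n) `^ gam * T `^ p^-1 + (1 - th ^+ n) * S.
    have nz : 1 - th != 0 by rewrite subr_eq0 gt_eqF.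
    by rewrite pow_half /S exprSr; field.
  rewrite exprSr invfM mulrA.
  exact: (le_trans (ler_distD (avg u (b (r / 2 ^+ n))) _ _) (lerD (step _ rn0 rnr) IH)).
have S0 : 0 <= S.
  by rewrite mulr_ge0 ?powR_ge0// mulr_ge0 ?powR_ge0// divr_ge0 ?(ltW A10)// subr_ge0 ltW.
apply/ler_addgt0Pr => e e0; have [del del0 He] := avg_cvg_center mms cu x e0.
(* Then [r / del < n < 2 ^ n], so the radius [r / 2 ^ n] is below [del]. *)
pose n := Num.bound (r / del).
have rn : r / 2 ^+ n < del.
  rewrite ltr_pdivrMr ?exprn_gt0// mulrC -ltr_pdivrMr//.
  apply: (@lt_trans _ _ n%:R).
    by apply: archi_boundP; rewrite divr_ge0 ?(ltW r0) ?(ltW del0).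
  by rewrite -natrX ltr_nat ltn_expl.
have rn0 : 0 < r / 2 ^+ n by rewrite divr_gt0// exprn_gt0.
rewrite [leRHS]addrC; apply: (le_trans (ler_distD (avg u (b (r / 2 ^+ n))) _ _)).
apply: lerD; first by rewrite distrC He.
apply: (le_trans (tele n)); rewrite -[leRHS]mul1r ler_wpM2r//.
by rewrite gerBl exprn_ge0.
Qed.

(** The values [u x] and [u y] are compared with the averages over [B(x, 2r)] and [B(y, r)], and
    these with each other, the second ball lying in the first. The point [y] may leave [K], so all
    local constants are taken on [K1]. *)
Lemma morrey_estimate K K1 : mcompact d K1 ->
  (forall x, K x -> mball d x 1 `<=` K1) -> exists A Lam Rad : R,
  [/\ 0 < A, 1 <= Lam, 0 < Rad &
  forall (u : X -> R) (g : X -> \bar R),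
    mcontinuous d (fun a b : R => `|a - b|) u ->
    upper_gradient d (fun a b : R => `|a - b|) u g ->
  forall x y r T, K x -> 0 < r -> r < Rad -> d x y < r -> 0 < T ->
    (\int[mu]_(z in mball d x (Lam * r)) (g z `^ p) <= T%:E)%E ->
    `|u x - u y| <= A * r `^ gam * T `^ p^-1].
Proof.
move=> cK1 KK1; have [A0 [sig0 [R0 [A00 sig01 R00 Hosc]]]] := mean_osc_le cK1.
have [A1 [sig1 [R1 [A10 sig11 R10 Hc]]]] := center_avg_le cK1.
have [Rd [Cd [Rd0 Cd1 Hd]]] := mball_doubling mms hom cK1.
have Cd0 : 0 < Cd by rewrite (lt_le_trans _ Cd1).
pose A := A1 * 2 `^ gam + Cd * 3 `^ Q * A0 * 2 `^ gam + A1.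
have A2 : 0 < A0 * 2 `^ gam by rewrite mulr_gt0// powR_gt0.
have A3 : 0 < A1 * 2 `^ gam by rewrite mulr_gt0// powR_gt0.
have A4 : 0 < Cd * 3 `^ Q by rewrite mulr_gt0// powR_gt0.
exists A, (2 * (sig0 + sig1)), (Num.min (Num.min 1 (Rd / 3)) (Num.min (R0 / 2) (R1 / 2))).
split; [by rewrite addr_gt0// addr_gt0// -mulrA mulr_gt0|lra| |].
  by rewrite !lt_min ltr01 !divr_gt0.
move=> u g cu ug x y r T Kx r0; rewrite !lt_min => /andP[/andP[r1 rd] /andP[r2 r3]].
move=> xy T0 gT; have [mg g0 _] := ug.
have K1x : K1 x by apply: KK1 Kx _ _; exact: mball_center mms _ _ _.
have K1y : K1 y by apply: KK1 Kx _ _; rewrite /mball/= (lt_trans xy).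
have yx : d y x < r by rewrite (metricC dM).
have r20 : 0 < 2 * r by rewrite mulr_gt0.
have intT z t : mball d z t `<=` mball d x (2 * (sig0 + sig1) * r) ->
    (\int[mu]_(w in mball d z t) (g w `^ p) <= T%:E)%E.
  by move=> zt; apply: le_trans gT; exact: integral_mball_sub.
have ux : `|u x - avg u (mball d x (2 * r))| <= A1 * (2 * r) `^ gam * T `^ p^-1.
  apply: (Hc u g) => //; first by rewrite mulrC -ltr_pdivlMr.
  by apply: intT; apply: (sub_mball mms); rewrite (metric_xx dM); nra.
have uy : `|avg u (mball d y r) - u y| <= A1 * r `^ gam * T `^ p^-1.
  rewrite distrC; apply: (Hc u g) => //; first by lra.
  by apply: intT; apply: (sub_mball mms); nra.
have uxy : `|avg u (mball d x (2 * r)) - avg u (mball d y r)| <=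
    Cd * 3 `^ Q * A0 * (2 * r) `^ gam * T `^ p^-1.
  have tE : (mean_osc mu (mball d x (2 * r)) u <= (A0 * (2 * r) `^ gam * T `^ p^-1)%:E)%E.
    apply: (Hosc u g) => //; first by rewrite mulrC -ltr_pdivlMr.
    by apply: intT; apply: (sub_mball mms); rewrite (metric_xx dM); nra.
  have bb : mball d y r `<=` mball d x (2 * r) by apply: (sub_mball mms); lra.
  rewrite distrC; apply: (le_trans (avg_mean_osc mms cu r0 r20 bb tE)).
  rewrite -(mulrA _ A0) -(mulrA _ (A0 * _)); apply: ler_wpM2r.
    by rewrite mulr_ge0 ?powR_ge0// mulr_ge0 ?powR_ge0// ltW.
  rewrite ler_pdivrMr ?(mu_mball_gt0 mms)//.
  (* [B(x, 2r)] lies in [B(y, 3r)], so doubling about [y] bounds the mass ratio by [Cd * 3 ^ Q]. *)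
  apply: le_trans (_ : fine (mu (mball d y (3 * r))) <= _).
    by apply: (le_mu_mball mms); apply: (sub_mball mms); lra.
  by apply: Hd => //; [lra|rewrite mulrC -ltr_pdivlMr].
have -> : A * r `^ gam * T `^ p^-1 = A1 * (2 * r) `^ gam * T `^ p^-1 +
   (Cd * 3 `^ Q * A0 * (2 * r) `^ gam * T `^ p^-1 + A1 * r `^ gam * T `^ p^-1).
  by rewrite powRM ?(ltW r0)// /A; ring.
apply: (le_trans (ler_distD (avg u (mball d x (2 * r))) _ _)); rewrite lerD//.
by apply: (le_trans (ler_distD (avg u (mball d y r)) _ _)); rewrite lerD.
Qed.

End Morrey.

(** * Energy near fibers with large image, and how many such fibers there are *)

Lemma powR_small {R : realType} (a e : R) : 0 < a -> 0 < e ->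
  exists2 del, 0 < del & forall r, 0 < r -> r < del -> r `^ a <= e.
Proof.
move=> a0 e0; exists (e `^ a^-1); first by rewrite powR_gt0.
move=> r r0 rdel; rewrite -[leRHS](@powRr1 _ e) ?(ltW e0)// -(mulVf (lt0r_neq0 a0)).
rewrite powRrM ge0_ler_powR ?nnegrE ?powR_ge0 ?(ltW a0) ?(ltW r0)//; exact: ltW.
Qed.

Section Foliation.
Context {R : realType} {disp : measure_display} {X : measurableType disp}.
Variables (dX : X -> X -> R) (mu : {measure set X -> \bar R}) (Q s p : R).
Variables (W : Type) (dW : W -> W -> R) (pi : X -> W).
Variables (Y : Type) (dY : Y -> Y -> R) (f : X -> Y) (g : X -> \bar R).
Hypotheses (Q1 : 1 <= Q) (s0 : 0 < s) (Qp : Q < p).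
Hypotheses (mms : proper_mms dX mu) (hom : locally_homogeneous dX mu Q)
  (poinc : local_poincare dX mu Q).
Hypotheses (dWM : is_metric dW) (DS : locally_DS_regular dX dW pi s).
Hypotheses (dYM : is_metric dY) (cf : mcontinuous dX dY f)
  (ug : upper_gradient dX dY f g) (gLp : Lp_loc dX mu p g).

Let dXM : is_metric dX. Proof. by case: mms. Qed.
Let Q0 : 0 < Q. Proof. exact: lt_le_trans Q1. Qed.
Let p0 : 0 < p. Proof. exact: lt_trans Qp. Qed.

(** Since [fine] sends an infinite integral to 0, comparisons of values rest on the finiteness facts
    [int_fin] and [int_mball_fin]. *)
Let nu (B : set X) : R := fine (\int[mu]_(x in B) (g x `^ p))%E.

Let g0 x : (0 <= g x)%E. Proof. by case: ug. Qed.
Let mgp D : measurable_fun D (fun x => g x `^ p)%E.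
Proof.
by apply: measurable_funTS; apply: (measurableT_comp (measurable_poweR p)); case: ug.
Qed.

Let int_ge0 B : (0 <= \int[mu]_(x in B) (g x `^ p))%E.
Proof. by apply: integral_ge0 => *; exact: poweR_ge0. Qed.

Let nu_ge0 B : 0 <= nu B. Proof. exact/fine_ge0/int_ge0. Qed.

Let int_fin K : mcompact dX K -> (\int[mu]_(x in K) (g x `^ p))%E \is a fin_num.
Proof.
move=> cK; rewrite ge0_fin_numE//; have [_ /(_ _ cK)] := gLp.
by under eq_integral do rewrite gee0_abs//.
Qed.

Let int_mball_fin K x r : mcompact dX K -> measurable K -> mball dX x r `<=` K ->
  (\int[mu]_(x in mball dX x r) (g x `^ p))%E \is a fin_num /\
  nu (mball dX x r) <= nu K.
Proof.
move=> cK mK xK.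
have le : (\int[mu]_(x in mball dX x r) (g x `^ p) <= \int[mu]_(x in K) (g x `^ p))%E.
  apply: ge0_subset_integral => //; first exact: measurable_mball mms _ _.
  by move=> *; exact: poweR_ge0.
have bfin : (\int[mu]_(x in mball dX x r) (g x `^ p))%E \is a fin_num.
  rewrite ge0_fin_numE// (le_lt_trans le)// -ge0_fin_numE//; exact: int_fin.
by split=> //; rewrite fine_le//; exact: int_fin.
Qed.

(** Morrey's estimate is for real functions; it is applied to the distance from [f x], for which [g]
    is still an upper gradient. The bound on [Rad] keeps the enlarged balls inside [K1], where the
    energy is finite. *)
Lemma dist_pow_le K K1 : mcompact dX K1 -> measurable K1 ->
  (forall x, K x -> mball dX x 1 `<=` K1) -> exists A Lam Rad : R,
  [/\ 0 < A, 1 <= Lam, 0 < Rad, Rad <= Lam^-1 &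
  forall x y r, K x -> 0 < r -> r < Rad -> dX x y < r ->
    dY (f x) (f y) `^ p <= A * r `^ (p - Q) * nu (mball dX x (Lam * r))].
Proof.
move=> cK1 mK1 KK1.
have [A [Lam [Rad [A0 Lam1 Rad0 H]]]] := morrey_estimate mms hom poinc Q1 Qp cK1 KK1.
have Lam0 : 0 < Lam by rewrite (lt_le_trans _ Lam1).
exists (A `^ p), Lam, (Num.min Rad Lam^-1); split=> //.
- by rewrite powR_gt0.
- by rewrite lt_min Rad0 invr_gt0.
- by rewrite ge_min lexx orbT.
move=> x y r Kx r0; rewrite lt_min => /andP[rRad rLam] xy.
have [bfin _] : (\int[mu]_(z in mball dX x (Lam * r)) (g z `^ p))%E \is a fin_num /\
    nu (mball dX x (Lam * r)) <= nu K1.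
  apply: int_mball_fin => //; apply: subset_trans (KK1 x Kx); apply: (sub_mball mms).
  by rewrite (metric_xx dXM) add0r mulrC -ler_pdivlMr// mul1r ltW.
pose u w := dY (f x) (f w).
have uu a b : `|u a - u b| <= dY (f a) (f b).
  have := metric_triangle dYM (f x) (f a) (f b).
  have := metric_triangle dYM (f x) (f b) (f a); rewrite (metricC dYM (f b) (f a)).
  by rewrite /u ler_norml; lra.
have cu : mcontinuous dX (fun a b => `|a - b|) u.
  move=> z e e0; have [del del0 h] := cf z e0; exists del => // w /h; exact: le_lt_trans.
have ugu : upper_gradient dX (fun a b : R => `|a - b|) u g.
  have [? ? h] := ug; split=> // c /h; apply: le_trans; by rewrite lee_fin.
have Ar0 : 0 < A `^ p * r `^ (p - Q) by rewrite mulr_gt0 ?powR_gt0.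
apply/ler_addgt0Pr => e e0.
(* The energy may vanish while Morrey's estimate wants [T > 0]; the slack becomes exactly [e] after
   multiplication by the constant. *)
pose T := nu (mball dX x (Lam * r)) + e / (A `^ p * r `^ (p - Q)).
have T0 : 0 < T by rewrite ltr_wpDl// divr_gt0.
have := H u g cu ugu x y r T Kx r0 rRad xy T0.
rewrite -(fineK bfin) lee_fin lerDl => /(_ (ltW (divr_gt0 e0 Ar0))).
rewrite /u (metric_xx dYM) sub0r normrN ger0_norm ?(metric_ge0 dYM)// => le.
have {le} : dY (f x) (f y) `^ p <= (A * r `^ (1 - Q / p) * T `^ p^-1) `^ p.
  by rewrite ge0_ler_powR ?nnegrE ?(metric_ge0 dYM) ?(ltW p0)// ?mulr_ge0 ?powR_ge0// ltW.
rewrite !powRM ?mulr_ge0 ?powR_ge0 ?(ltW A0)// -!powRrM mulVf ?gt_eqF//.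
rewrite powRr1 ?(ltW T0)// mulrBl mul1r divfK ?gt_eqF// => /le_trans; apply.
by rewrite /T mulrDr mulrCA divff ?mulr1// gt_eqF.
Qed.

Section Fiber.
Variables (K K1 : set X) (al eps : R).
Hypotheses (cK : mcompact dX K) (cK1 : mcompact dX K1) (mK1 : measurable K1)
  (KK1 : forall x, K x -> mball dX x 1 `<=` K1)
  (sal : s < al) (alp : al < p) (eps0 : 0 < eps).

Let fiber a := (pi @^-1` [set a]) `&` K.
Let b := Q - s - p * (1 - s / al).

(** [eps] is both the scale and the threshold, so that a single sequence of values of [eps] catches
    every fiber whose image has a positive premeasure at some scale. *)
Let big_fibers :=
  [set a | (eps%:E < hausdorff_delta dY al eps (f @` fiber a))%E].

(** The images of the balls have diameters at most [D i], with [D i ^ p] of order [r ^ (p - Q)]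
    times the energy [v i], while the sum of the [D i ^ al] exceeds [eps]. A threshold [t] absorbs
    half of [eps] and leaves a lower bound on the energies. *)
Lemma fiber_energy_lower_bound : exists Lam C c R1 : R,
  [/\ 1 <= Lam, 0 < C, 0 < c, 0 < R1 &
  forall r, 0 < r -> r < R1 -> Lam * (C * r) < 1 /\
    forall a, big_fibers a -> exists n (z : 'I_n -> X), [/\ forall i, fiber a (z i),
      separated dX (2 * (C * r)) z &
      c * r `^ b <= \sum_i nu (mball dX (z i) (Lam * (C * r)))]].
Proof.
have [A [Lam [Rad [A0 Lam1 Rad0 RadL H]]]] := dist_pow_le cK1 mK1 KK1.
have [_ /(_ K cK)[_ [C [r0 [C1 r00 HC]]]]] := DS.
have Lam0 : 0 < Lam by rewrite (lt_le_trans _ Lam1).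
have C0 : 0 < C by rewrite (lt_le_trans _ C1).
have al0 : 0 < al by exact: lt_trans sal.
have pQ : 0 < p - Q by rewrite subr_gt0.
pose M := nu K1.
pose A2 := 2 `^ p * (A * (2 * C) `^ (p - Q)).
have A20 : 0 < A2 by rewrite mulr_gt0 ?powR_gt0// mulr_gt0 ?powR_gt0// mulr_gt0.
have M1 : 0 < M + 1 by rewrite ltr_wpDl ?nu_ge0.
(* Below [r1] every [D i] is at most [eps], so the images form an admissible cover at scale
   [eps]. *)
have [r1 r10 Hr1] := @powR_small _ (p - Q) (eps `^ p / (A2 * (M + 1))) pQ
  (divr_gt0 (powR_gt0 _ eps0) (mulr_gt0 A20 M1)).
pose c := eps / 2 * (eps / (2 * C)) `^ ((p - al) / al) / A2.
have eC0 : 0 < eps / (2 * C) by rewrite divr_gt0// mulr_gt0.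
exists (2 * Lam), C, c, (Num.min (Num.min r0 r1) (Rad / (2 * C))); split=> //.
- lra.
- by rewrite divr_gt0// mulr_gt0 ?powR_gt0// divr_gt0.
- by rewrite !lt_min r00 r10 divr_gt0// mulr_gt0.
move=> r r_gt0; rewrite !lt_min => /andP[/andP[rr0 rr1] rRad].
have rho0 : 0 < C * r by rewrite mulr_gt0.
have rhoRad : 2 * (C * r) < Rad by rewrite mulrA mulrC -ltr_pdivlMr// mulr_gt0.
have Lrho : 2 * Lam * (C * r) < 1.
  by rewrite -mulrA mulrCA mulrC -ltr_pdivlMr// mul1r (lt_le_trans rhoRad).
split=> // a abig.
have [n0 [e [n0C cov]]] := HC a r r_gt0 rr0.
have fcov : fiber a `<=` \bigcup_i mball dX (e i) (C * r).
  move=> x [pix Kx]; apply: cov; split=> //.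
  by rewrite /mball/preimage/= pix (metric_xx dWM).
(* The covering balls of the regularity condition may be centered off the fiber. A maximal separated
   family has its centers in the fiber, no more members, and covers the fiber at twice the
   radius. *)
have bound n (z : 'I_n -> X) : (forall i, fiber a (z i)) ->
    separated dX (2 * (C * r)) z -> (n <= n0)%N.
  by move=> zf zs; have := separated_card_le dXM fcov zf zs; rewrite card_ord.
have [n [z [zf zs zmax]]] := maximal_separated dXM bound.
exists n, z; split=> //.
have nn0 := bound _ _ zf zs.
pose v i := nu (mball dX (z i) (2 * Lam * (C * r))).
pose D i := 2 * (A * (2 * (C * r)) `^ (p - Q) * v i) `^ p^-1.
have v0 i : 0 <= v i by exact: nu_ge0.
have D0 i : 0 <= D i by rewrite mulr_ge0 ?powR_ge0.
have base0 i : 0 <= A * (2 * (C * r)) `^ (p - Q) * v i.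
  by rewrite mulr_ge0// mulr_ge0 ?powR_ge0// ltW.
have Dp i : D i `^ p = A2 * r `^ (p - Q) * v i.
  rewrite powRM ?powR_ge0// -powRrM mulVf ?gt_eqF// powRr1//.
  by rewrite (mulrA 2) (@powRM _ (2 * C)) ?(ltW r_gt0) ?mulr_ge0 ?(ltW C0)// /A2; ring.
have vM i : v i <= M.
  apply: (int_mball_fin cK1 mK1 _).2; apply: subset_trans (KK1 (zf i).2).
  by apply: (sub_mball mms); rewrite (metric_xx dXM) add0r ltW.
have Deps i : D i <= eps.
  rewrite leNgt; apply/negP => lt.
  have := gt0_ltr_powR p0 (ltW eps0 : eps \in Num.nneg) (D0 i : D i \in Num.nneg) lt.
  apply/negP; rewrite -leNgt Dp.
  apply: (@le_trans _ _ (A2 * r `^ (p - Q) * (M + 1))).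
    apply: ler_wpM2l; first by rewrite mulr_ge0 ?powR_ge0 ?(ltW A20).
    by apply: (le_trans (vM i)); rewrite lerDl.
  rewrite (_ : A2 * _ * _ = r `^ (p - Q) * (A2 * (M + 1))); last by ring.
  by rewrite -ler_pdivlMr; [exact: Hr1|exact: mulr_gt0].
have diamD i : (mdiam dY (f @` mball dX (z i) (2 * (C * r))) <= (D i)%:E)%E.
  have dz y : mball dX (z i) (2 * (C * r)) y -> dY (f (z i)) (f y) <= D i / 2.
    move=> zy.
    have le : dY (f (z i)) (f y) `^ p <= A * (2 * (C * r)) `^ (p - Q) * v i.
      rewrite /v (_ : 2 * Lam * (C * r) = Lam * (2 * (C * r))); last by ring.
      by apply: H => //; [exact: (zf i).2|rewrite mulr_gt0].
    rewrite /D mulrC mulKf//.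
    rewrite [leLHS](_ : _ = (dY (f (z i)) (f y) `^ p) `^ p^-1); last first.
      by rewrite -powRrM mulfV ?gt_eqF// powRr1 ?(metric_ge0 dYM).
    by apply: ge0_ler_powR; rewrite ?nnegrE ?powR_ge0 ?invr_ge0 ?(ltW p0) ?base0.
  apply: mdiam_le => // _ _ [y zy <-] [y' zy' <-].
  have := metric_triangle dYM (f y) (f (z i)) (f y').
  rewrite (metricC dYM (f y) (f (z i))); have := dz _ zy; have := dz _ zy'; lra.
have fE : f @` fiber a `<=` \bigcup_i (f @` mball dX (z i) (2 * (C * r))).
  by move=> _ [x fx <-]; have [i zx] := zmax _ fx; exists i => //; exists x.
have := lt_le_trans abig (hausdorff_delta_finite_cover al0 (ltW eps0) fE diamD Deps).
rewrite lte_fin => sumD.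
(* Chosen so that [n * t ^ al <= eps / 2] follows from [n <= C * r ^ (- s)]. *)
pose t := (eps / (2 * C) * r `^ s) `^ al^-1.
have t0 : 0 < t by rewrite powR_gt0// mulr_gt0// powR_gt0.
have tal : t `^ al = eps / (2 * C) * r `^ s.
  by rewrite -powRrM mulVf ?gt_eqF// powRr1// mulr_ge0 ?powR_ge0// ltW.
have : eps < n%:R * t `^ al + t `^ (al - p) * (A2 * r `^ (p - Q) * \sum_i v i).
  apply: (lt_le_trans sumD).
  apply: (@le_trans _ _ (\sum_(i < n) (t `^ al + t `^ (al - p) * D i `^ p))).
    by apply: ler_sum => i _; exact: powR_threshold.
  rewrite big_split/= sumr_const card_ord mulr_natl lerD2l -mulr_sumr.
  rewrite (_ : _ * \sum_i v i = \sum_i D i `^ p)//.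
  by rewrite mulr_sumr; apply: eq_bigr => i _; rewrite Dp.
have ntal : n%:R * t `^ al <= eps / 2.
  rewrite tal; apply: (@le_trans _ _ (C * r `^ (- s) * (eps / (2 * C) * r `^ s))).
    apply: ler_wpM2r; first by rewrite mulr_ge0 ?powR_ge0 ?(ltW eC0).
    by apply: (le_trans _ n0C); rewrite ler_nat.
  rewrite powRN le_eqVlt; apply/orP; left; apply/eqP; field.
  by rewrite !gt_eqF ?powR_gt0.
move=> sumv.
have tp0 : 0 < t `^ (p - al) by rewrite powR_gt0.
have Ar0 : 0 < A2 * r `^ (p - Q) by rewrite mulr_gt0 ?powR_gt0.
have {sumv} : eps / 2 <= (t `^ (p - al))^-1 * (A2 * r `^ (p - Q) * \sum_i v i).
  by rewrite -powRN opprB; move: sumv ntal; lra.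
rewrite ler_pdivlMl// [leRHS]mulrC -ler_pdivrMr//.
apply: le_trans; rewrite le_eqVlt; apply/orP; left; apply/eqP.
have -> : t `^ (p - al) = (eps / (2 * C)) `^ ((p - al) / al) * r `^ (s * ((p - al) / al)).
  by rewrite /t -powRrM [al^-1 * _]mulrC powRM ?powR_ge0 ?(ltW eC0)// -powRrM.
(* This identity of exponents is the origin of [b]: the first power comes from [t], the second from
   Morrey's estimate. *)
have -> : r `^ b = r `^ (s * ((p - al) / al)) / r `^ (p - Q).
  rewrite -powRB ?(gt_eqF r_gt0) ?implybT//; congr (_ `^ _); rewrite /b; field.
  by rewrite gt_eqF.
rewrite /c; field.
by rewrite !gt_eqF ?powR_gt0.
Qed.

(** Each of [n] separated points carries energy at least [c * r ^ b] around its fiber, and bounded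
    overlap caps the total by [N * M]. So [n] is at most of order [r ^ (- b)], and a cover by balls
    of radius of order [r] has [t]-size of order [r ^ (t - b)]. *)
Lemma big_fibers_null t : 0 < t -> b < t -> hausdorff_measure dW t big_fibers = 0%E.
Proof.
move=> t0 bt.
have [Lam [C [c [R1 [Lam1 C0 c0 R10 H]]]]] := fiber_energy_lower_bound.
have [N [R2 [R20 Hov]]] : exists (N : nat) (R2 : R), 0 < R2 /\
    forall (I : finType) (z : I -> X) (rho : R), 0 < rho -> rho < R2 ->
    (forall i, K (z i)) -> separated dX (2 * rho) z ->
    forall y, (count (fun i => y \in mball dX (z i) (Lam * rho)) (index_enum I) <= N)%N.
  by have [Rad [N ?]] := bounded_overlap mms hom cK Lam1; exists N, Rad.
have [L L0 HL] : exists2 L, 0 < L &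
    forall x y, K x -> K y -> dW (pi x) (pi y) <= L * dX x y.
  (* The given Lipschitz constant may be nonpositive; a positive one can be cancelled later. *)
  have [_ /(_ K cK)[[L HL] _]] := DS; exists (Num.max 1 L); first by rewrite lt_max ltr01.
  move=> x y Kx Ky; apply: (le_trans (HL _ _ Kx Ky)).
  by rewrite ler_wpM2r ?(metric_ge0 dXM)// le_max lexx orbT.
pose M := nu K1; have M0 : 0 <= M by exact: nu_ge0.
have count_le r n (a : 'I_n -> W) : 0 < r -> r < R1 -> C * r < R2 ->
    (forall j, big_fibers (a j)) -> separated dW (L * (2 * (C * r))) a ->
    n%:R <= N%:R * M / c * r `^ (- b).
  move=> r0 rR1 rR2 abig asep; have [Lr Hr] := H _ r0 rR1.
  have /choice[z Hz] : forall j, exists z : {m & 'I_m -> X},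
      [/\ forall i, fiber (a j) (projT2 z i), separated dX (2 * (C * r)) (projT2 z) &
      c * r `^ b <= \sum_i nu (mball dX (projT2 z i) (Lam * (C * r)))].
    by move=> j; have [m [z Hz]] := Hr _ (abig j); exists (existT _ m z).
  (* All centers over all chosen points form one family. Within a fiber they are separated by
     construction, across fibers because [pi] is [L]-Lipschitz on [K]. *)
  pose I : finType := {j : 'I_n & 'I_(projT1 (z j))}.
  pose zz (k : I) := projT2 (z (projT1 k)) (projT2 k).
  have zzf k : fiber (a (projT1 k)) (zz k) by have [+ _ _] := Hz (projT1 k); exact.
  have zzK k : K (zz k) by have [] := zzf k.
  have zzsep : separated dX (2 * (C * r)) zz.
    move=> [j i] [j' i']; case: (eqVneq j j') => [jj'|jj' _].
      subst j' => ij; have [_ + _] := Hz j; apply.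
      by apply: contraNneq ij => /= ->.
    rewrite -(ler_pM2l L0); apply: le_trans (asep _ _ jj') _.
    have [/= e1 _] := zzf (existT _ j i); have [/= e2 _] := zzf (existT _ j' i').
    by rewrite -e1 -e2; exact: HL.
  have BK1 k : mball dX (zz k) (Lam * (C * r)) `<=` K1.
    apply: subset_trans (KK1 (zzK k)); apply: (sub_mball mms).
    by rewrite (metric_xx dXM) add0r ltW.
  have rho0 : 0 < C * r by rewrite mulr_gt0.
  have sum_le : \sum_k nu (mball dX (zz k) (Lam * (C * r))) <= N%:R * M.
    have := @sum_integral_le_overlap R _ X mu I (index_enum I)
      (fun k => mball dX (zz k) (Lam * (C * r))) K1 (fun x => g x `^ p)%E N mK1
      (fun k => measurable_mball mms _ _) BK1 (@mgp K1) (fun _ _ => poweR_ge0 _ _)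
      (fun y _ => Hov I zz (C * r) rho0 rR2 zzK zzsep y).
    rewrite -(fineK (int_fin cK1)) -EFinM.
    rewrite (eq_bigr (fun k => (nu (mball dX (zz k) (Lam * (C * r))))%:E)).
      by rewrite sumEFin lee_fin.
    by move=> k _; rewrite fineK//; have [] := int_mball_fin cK1 mK1 (BK1 k).
  have rb0 : 0 < r `^ b by rewrite powR_gt0.
  rewrite powRN ler_pdivlMr// ler_pdivlMr// -mulrA [r `^ b * c]mulrC.
  apply: le_trans sum_le.
  have -> : n%:R * (c * r `^ b) = \sum_(j < n) c * r `^ b.
    by rewrite sumr_const card_ord mulr_natl.
  apply: le_trans (_ : \sum_j \sum_i nu (mball dX (projT2 (z j) i) (Lam * (C * r))) <= _).
    by apply: ler_sum => j _; have [] := Hz j.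
  by rewrite sig_big_dep.
apply/hausdorff_measure_eq0 => del del0.
apply/eqP; rewrite eq_le hausdorff_delta_ge0 andbT.
apply/lee_addgt0Pr => e e0; rewrite add0e.
pose G := N%:R * M / c * (4 * L * C) `^ t.
have NMc0 : 0 <= N%:R * M / c by rewrite divr_ge0 ?mulr_ge0// ltW.
have G0 : 0 <= G by rewrite mulr_ge0 ?powR_ge0.
have G10 : 0 < G + 1 by rewrite ltr_wpDl.
have tb0 : 0 < t - b by rewrite subr_gt0.
(* [G] vanishes if the total energy does, so [G + 1] is used as the divisor. *)
have [r3 r30 Hr3] := powR_small tb0 (divr_gt0 e0 G10).
have LC0 : 0 < 4 * L * C by rewrite mulr_gt0// mulr_gt0.
pose m := Num.min (Num.min R1 (R2 / C)) (Num.min (del / (4 * L * C)) r3).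
have m0 : 0 < m by rewrite !lt_min R10 r30 !divr_gt0.
have [r r0 rm] : exists2 r, 0 < r & r < m.
  by exists (m / 2); [rewrite divr_gt0|rewrite ltr_pdivrMr// ltr_pMr// ltr1n].
move: rm; rewrite !lt_min => /andP[/andP[rR1 rR2] /andP[rdel rr3]].
have CrR2 : C * r < R2 by rewrite mulrC -ltr_pdivlMr.
have {rdel} rdel : 4 * L * C * r < del by rewrite mulrC -ltr_pdivlMr.
(* This integer bound only ensures that a maximal family exists; the size estimate goes through
   [count_le] again. *)
have nbound n (a : 'I_n -> W) : (forall j, big_fibers (a j)) ->
    separated dW (L * (2 * (C * r))) a -> (n <= Num.bound (N%:R * M / c * r `^ (- b)))%N.
  move=> abig asep; rewrite -(ler_nat R) ltW//.
  apply: le_lt_trans (count_le _ _ _ r0 rR1 CrR2 abig asep) _.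
  by apply: archi_boundP; rewrite mulr_ge0 ?powR_ge0.
have [n [a [abig asep amax]]] := maximal_separated dWM nbound.
have acov : big_fibers `<=` \bigcup_i mball dW (a i) (L * (2 * (C * r))).
  by move=> w /amax[i wi]; exists i.
have adiam i : (mdiam dW (mball dW (a i) (L * (2 * (C * r)))) <= (4 * L * C * r)%:E)%E.
  apply: mdiam_le; first by rewrite mulr_ge0// ltW.
  move=> x y; rewrite /mball/= => ax ay.
  have := metric_triangle dWM x (a i) y; rewrite (metricC dWM x (a i)); lra.
apply: (le_trans (hausdorff_delta_finite_cover t0 (ltW del0) acov adiam (fun=> ltW rdel))).
rewrite lee_fin sumr_const card_ord -[leLHS]mulr_natl.
apply: (@le_trans _ _ (N%:R * M / c * r `^ (- b) * (4 * L * C * r) `^ t)).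
  by apply: ler_wpM2r; [exact: powR_ge0|exact: count_le asep].
rewrite powRM ?(ltW LC0) ?(ltW r0)//.
rewrite (_ : _ * _ = G * r `^ (t - b)); last first.
  by rewrite powRD ?(gt_eqF r0) ?implybT// /G; ring.
apply: (@le_trans _ _ ((G + 1) * r `^ (t - b))).
  by rewrite ler_wpM2r ?powR_ge0// lerDl.
by rewrite mulrC -ler_pdivlMr//; exact: Hr3.
Qed.

End Fiber.
End Foliation.

(** * Exhaustion by compact sets and scales, and the limit in the exponent *)

Theorem theorem1p4 (R : realType) (Q s p : R)
  (disp : measure_display) (X : measurableType disp) (dX : X -> X -> R)
  (mu : {measure set X -> \bar R})
  (W : Type) (dW : W -> W -> R) (pi : X -> W)
  (Y : Type) (dY : Y -> Y -> R) (f : X -> Y) (g : X -> \bar R) :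
  1 <= Q -> 0 < s -> s < Q ->
  proper_mms dX mu -> locally_homogeneous dX mu Q -> local_poincare dX mu Q ->
  is_metric dW -> mproper dW -> locally_DS_regular dX dW pi s ->
  is_metric dY -> Q < p ->
  mcontinuous dX dY f -> upper_gradient dX dY f g -> Lp_loc dX mu p g ->
  forall alpha : R, s < alpha -> alpha <= p * s / (p - Q + s) ->
    (hdim dW [set a : W | (alpha%:E <= hdim dY (f @` (pi @^-1` [set a])))%E]
      <= ((Q - s) - p * (1 - s / alpha))%:E)%E.
Proof.
move=> Q1 s0 sQ mms hom poinc dWM _ DS dYM Qp cf ug gLp alpha salpha alphale.
have p0 : 0 < p by lra.
have alpha0 : 0 < alpha by exact: lt_trans salpha.
have pQs : 0 < p - Q + s by lra.
have alphap : alpha < p.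
  by rewrite (le_lt_trans alphale)// ltr_pdivrMr// ltr_pM2l//; lra.
(* The upper bound on [alpha] says exactly this; it makes [t] positive, as the exponents in [hdim]
   must be. *)
have bound0 : 0 <= (Q - s) - p * (1 - s / alpha).
  have -> : (Q - s) - p * (1 - s / alpha) = p * s / alpha - (p - Q + s).
    by field; rewrite gt_eqF.
  by rewrite subr_ge0 ler_pdivlMr// mulrC -ler_pdivlMr.
set A := [set a | _].
apply/lee_addgt0Pr => e e0; rewrite -EFinD; set t := (_ + e).
have t0 : 0 < t by rewrite ltr_wpDl.
apply: ereal_inf_lbound; exists t => //; split=> //.
(* A base point is needed for the exhaustion by balls. If [X] is empty, so is [W], because [pi] is
   onto. *)
have [x0|noX] := pselect (exists x : X, True); last first.
  apply/hausdorff_measure_eq0 => del del0.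
  apply/eqP; rewrite eq_le hausdorff_delta_ge0 andbT.
  have := @hausdorff_delta_finite_cover R W dW t del A 0 (fun=> set0) (fun=> 0) t0 (ltW del0).
  rewrite big_ord0; apply; [|by case|by case].
  by move=> a _; have [/(_ a)[x _] _] := DS; exfalso; apply: noX; exists x.
case: x0 => x0 _.
pose h := t - (Q - s - p).
have ht : p * s / alpha < h by rewrite /h /t; lra.
have h0 : 0 < h by apply: lt_trans ht; rewrite divr_gt0// mulr_gt0.
(* Any [al] strictly between this maximum and [alpha] would do: [p * s / h < al] is the condition
   that the exponent at [al] stays below [t]. *)
pose al := (Num.max s (p * s / h) + alpha) / 2.
have mal : Num.max s (p * s / h) < alpha.
  by rewrite gt_max salpha/= ltr_pdivrMr// [alpha * h]mulrC -ltr_pdivrMr.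
have sal : s < al.
  have : s <= Num.max s (p * s / h) by rewrite le_max lexx.
  rewrite /al; lra.
have hal : p * s / h < al.
  have : p * s / h <= Num.max s (p * s / h) by rewrite le_max lexx orbT.
  rewrite /al; lra.
have alalpha : al < alpha by rewrite /al; lra.
have al0 : 0 < al by exact: lt_trans sal.
have alp : al < p by exact: lt_trans alphap.
have bt : Q - s - p * (1 - s / al) < t.
  have : p * s / al < h by rewrite ltr_pdivrMr// [h * al]mulrC -ltr_pdivrMr.
  have -> : Q - s - p * (1 - s / al) = p * s / al + (Q - s - p) by ring.
  by rewrite /h; lra.
pose K n := mcball dX x0 n%:R.
pose B n k := [set a | (k.+1%:R^-1%:E <
  hausdorff_delta dY al k.+1%:R^-1 (f @` ((pi @^-1` [set a]) `&` K n)))%E].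
have dXM : is_metric dX by case: mms.
have pX : mproper dX by case: mms.
apply: (@hausdorff_measure_sub_eq0 _ _ _ _ _ (\bigcup_n \bigcup_k B n k)); last first.
  apply: hausdorff_measure_bigcup_eq0 => n; apply: hausdorff_measure_bigcup_eq0 => k.
  apply: (big_fibers_null Q1 s0 Qp mms hom poinc dWM DS dYM cf ug gLp
    (K := K n) (K1 := K n.+1)) => //.
  - exact: pX.
  - exact: pX.
  - exact: measurable_mcball mms _ _.
  - move=> x; rewrite /K /mcball/mball/= => x0x y /= xy.
    by rewrite -natr1; have := metric_triangle dXM x0 x y; lra.
move=> a; rewrite /A/= => aA; apply: contrapT => noB.
(* A point outside every [B n k] has an image of its fiber that is [al]-null on each [K n], hence of
   dimension at most [al < alpha]. *)
have Hn n : hausdorff_measure dY al (f @` ((pi @^-1` [set a]) `&` K n)) = 0%E.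
  apply/hausdorff_measure_eq0 => del del0; apply/eqP.
  rewrite eq_le hausdorff_delta_ge0 andbT leNgt; apply/negP => gt0.
  set H := hausdorff_delta _ _ _ _ in gt0.
  (* [H] may be infinite, so a finite positive value below it is taken. Then [1 / (k + 1)] is made
     smaller than both [v] and [del], and shrinking the scale only increases the premeasure. *)
  have [v v0 vH] : exists2 v, 0 < v & (v%:E < H)%E.
    case: H gt0 => [v| |]//; last by exists 1; rewrite ?ltry.
    by rewrite lte_fin => v0; exists (v / 2); [rewrite divr_gt0|rewrite lte_fin; lra].
  pose m := Num.min v del; have m0 : 0 < m by rewrite lt_min v0.
  pose k := Num.bound m^-1.
  have km : k.+1%:R^-1 < m.
    rewrite invf_plt ?posrE//; apply: (@lt_trans _ _ k%:R).
      by apply: archi_boundP; rewrite invr_ge0 ltW.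
    by rewrite ltr_nat.
  move: km; rewrite lt_min => /andP[kv kdel].
  apply: noB; exists n => //; exists k => //=.
  apply: (@lt_trans _ _ v%:E); first by rewrite lte_fin.
  exact: lt_le_trans vH (hausdorff_delta_anti _ _ _ (ltW kdel)).
move: aA; apply/negP; rewrite -ltNge.
apply: (@le_lt_trans _ _ al%:E); last by rewrite lte_fin.
apply: ereal_inf_lbound; exists al => //; split=> //.
apply: hausdorff_measure_sub_eq0 (hausdorff_measure_bigcup_eq0 Hn).
move=> _ [x xa <-]; exists (Num.bound (dX x0 x)) => //; exists x => //; split=> //.
by apply: ltW; apply: archi_boundP; exact: metric_ge0 dXM _ _.
Qed.
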